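(* Let $A,B$ be finite-dimensional Hilbert spaces with reference spaces $A_R,B_R$, let $\rho^B\in\mathcal{D}(B)$ be an arbitrary state, $\mathcal{N}_W:A_R\to B_R$ a CPTP map, and $\rho^{B_R}=(\rho^B)^T$. (1) If there exists an $(n,\Theta,\epsilon)$ lossy quantum compression protocol for the setup $(\rho^B,\mathcal{N}_W)$ with the restriction that its decoding map $\mathcal{D}^{(n)}$ is an isometry (i.e. conjugation by an isometry $M\to A^{\otimes n}$), then there exists an $(n,\Theta,\epsilon)$ quantum covering code for the setup $(\rho^{B_R},\mathcal{N}_W)$. (2) Conversely, if there exists an $(n,\Theta,\epsilon)$ quantum covering code for the setup $(\rho^{B_R},\mathcal{N}_W)$, then there exists an $(n,\Theta,4\sqrt\epsilon)$ lossy quantum compression protocol for the setup $(\rho^B,\mathcal{N}_W)$.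
   Context: $\mathcal{D}(A)$ denotes density operators on $A$. Canonical purifications: for each space $A$ fix a reference space $A_R\simeq A$ and orthonormal bases, and let $|\Gamma\rangle_{A_RA}=\sum_i|i\rangle^{A_R}\otimes|i\rangle^A$. The canonical purification of $\sigma\in\mathcal{D}(A)$ is $|\psi_\sigma\rangle^{A_RA}=(\mathbb{1}_{A_R}\otimes\sqrt\sigma)|\Gamma\rangle_{A_RA}$, with density operator $\Psi_\sigma^{A_RA}$. The transpose is $\tau^T=\sum_{i,i'}|i\rangle\langle i'|^{A_R}\,\langle i'|\tau|i\rangle^A$, so $\mathrm{Tr}_A\Psi_\sigma^{A_RA}=\sigma^T$. Lossy compression protocol: for the source coding setup $(\rho^B,\mathcal{N}_W)$, an $(n,\Theta,\epsilon)$ lossy quantum compression protocol consists of CPTP maps $\mathcal{E}^{(n)}:B^{\otimes n}\to M$ (encoder) and $\mathcal{D}^{(n)}:M\to A^{\otimes n}$ (decoder) with $\dim M=\Theta$ such that $$\frac12\left\|\omega^{B_R^nA^n}-(\mathcal{N}_W^{\otimes n}\otimes\mathrm{id}_{A^n})\Psi_\omega^{A_R^nA^n}\right\|_1\le\epsilon,$$ where $\omega^{B_R^nA^n}=(\mathrm{id}\otimes\mathcal{D}^{(n)}\circ\mathcal{E}^{(n)})(\Psi_\rho^{B_R^nB^n})$, $\Psi_\rho^{B_R^nB^n}$ is the canonical purification of $(\rho^B)^{\otimes n}$, and $\Psi_\omega^{A_R^nA^n}$ is the canonical purification of $\omega^{A^n}=\mathrm{Tr}_{B_R^n}\omega^{B_R^nA^n}$.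 Covering code: an $(n,\Theta,\epsilon)$ quantum covering code for $(\rho^{B_R},\mathcal{N}_W)$ is a density operator $\hat\sigma$ on $A_R^{\otimes n}$ whose rank equals $\Theta$ and such that $\frac12\|(\rho^{B_R})^{\otimes n}-\mathcal{N}_W^{\otimes n}(\hat\sigma)\|_1\le\epsilon$.
   Formalization: Part (1) is false with rank exactly Θ (encoder output may not have full rank on M); it is proved that a covering code of some rank Θ' ≤ Θ with the same n, ε exists, and one of rank exactly Θ when the encoder's output on the n-fold source state has rank Θ. *)

(* Defs.v *)
From HB Require Import structures.
From mathcomp Require Import all_boot all_order all_algebra.
From mathcomp Require Import reals complex mxtens.

Set Implicit Arguments.
Unset Strict Implicit.
Unset Printing Implicit Defensive.

Import Order.TTheory GRing.Theory Num.Theory.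
Local Open Scope ring_scope.

(* A d-dimensional Hilbert space with a fixed orthonormal basis is C^d, and its
   reference space is another copy of C^d, so that sigma |-> sigma^T (an
   operator on the reference space) is the matrix transpose.  Tensor products
   are Kronecker products A *t B, C^d (x) C^e = C^(d * e), and the basis
   of the n-fold tensor power C^(d ^ n) is the product basis. *)

Definition adjmx (C : numClosedFieldType) m n (X : 'M[C]_(m, n)) : 'M[C]_(n, m) :=
  map_mx Num.conj X^T.

(* Over C, 0 <= z includes that z is real; hence psdmx X forces X Hermitian. *)
Definition psdmx (C : numClosedFieldType) d (X : 'M[C]_d) : Prop :=
  forall v : 'cV[C]_d, 0 <= (adjmx v *m X *m v) 0 0.

Definition density (C : numClosedFieldType) d (X : 'M[C]_d) : Prop :=
  psdmx X /\ \tr X = 1.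

(* Functional calculus; meaningful for psd X, for which it is the psd root. *)
Definition sqrtmx (C : numClosedFieldType) d (X : 'M[C]_d) : 'M[C]_d :=
  invmx (spectralmx X) *m diag_mx (map_mx sqrtC (spectral_diag X))
    *m spectralmx X.

(* ||X||_1 = Tr sqrt (X^dagger X); the trace is real, so Re only changes its type. *)
Definition trnorm (R : realType) d (X : 'M[R[i]]_d) : R :=
  complex.Re (\tr (sqrtmx (adjmx X *m X))).

Definition trdist (R : realType) d (X Y : 'M[R[i]]_d) : R :=
  2^-1 * trnorm (X - Y).

(* N (x) M, defined on matrix units and extended linearly; meaningful for
   linear N and M. *)
Definition tensmap (C : numClosedFieldType) p q r s
    (N : 'M[C]_p -> 'M[C]_q) (M : 'M[C]_r -> 'M[C]_s)
    (X : 'M[C]_(p * r)) : 'M[C]_(q * s) :=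
  \sum_(i < p) \sum_(j < p) \sum_(k < r) \sum_(l < r)
    X (mxtens_index (i, k)) (mxtens_index (j, l))
      *: (N (delta_mx i j) *t M (delta_mx k l)).

(* N^{(x) n}, following the recursion of ntensmx (A ^t n) in mxtens. *)
Fixpoint ntensmap_rec (C : numClosedFieldType) p q
    (N : 'M[C]_p -> 'M[C]_q) n : 'M[C]_(p ^ n.+1) -> 'M[C]_(q ^ n.+1) :=
  if n is n'.+1 return 'M[C]_(p ^ n.+1) -> 'M[C]_(q ^ n.+1)
  then tensmap N (@ntensmap_rec C p q N n') else N.

Definition ntensmap (C : numClosedFieldType) p q
    (N : 'M[C]_p -> 'M[C]_q) n : 'M[C]_(p ^ n) -> 'M[C]_(q ^ n) :=
  if n is n'.+1 return 'M[C]_(p ^ n) -> 'M[C]_(q ^ n)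
  then @ntensmap_rec C p q N n' else id.
Arguments ntensmap {C p q} N n X.

Definition cptp (C : numClosedFieldType) p q
    (N : {linear 'M[C]_p -> 'M[C]_q}) : Prop :=
  (forall k (X : 'M[C]_(k * p)), psdmx X -> psdmx (tensmap id N X)) /\
  (forall X : 'M[C]_p, \tr (N X) = \tr X).

Definition isometric_channel (C : numClosedFieldType) p q
    (N : {linear 'M[C]_p -> 'M[C]_q}) : Prop :=
  exists V : 'M[C]_(q, p),
    adjmx V *m V = 1%:M /\ forall X, N X = V *m X *m adjmx V.

(* Trace over the first tensor factor. *)
Definition ptrace1 (C : numClosedFieldType) p q (X : 'M[C]_(p * q)) : 'M[C]_q :=
  \matrix_(i, j) \sum_(k < p) X (mxtens_index (k, i)) (mxtens_index (k, j)).

(* |Gamma> = sum_i |i> (x) |i>, reference space first. *)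
Definition Gamma (C : numClosedFieldType) d : 'cV[C]_(d * d) :=
  \sum_(i < d) (delta_mx i 0 : 'cV[C]_d) *t (delta_mx i 0 : 'cV[C]_d).

Definition canon_vec (C : numClosedFieldType) d (sigma : 'M[C]_d) :
    'cV[C]_(d * d) :=
  ((1%:M : 'M[C]_d) *t sqrtmx sigma) *m Gamma C d.

Definition canon_pur (C : numClosedFieldType) d (sigma : 'M[C]_d) :
    'M[C]_(d * d) :=
  canon_vec sigma *m adjmx (canon_vec sigma).

(* omega^{B_R^n A^n} *)
Definition protocol_output (C : numClosedFieldType) a b (rho : 'M[C]_b)
    n Theta (E : {linear 'M[C]_(b ^ n) -> 'M[C]_Theta})
    (D : {linear 'M[C]_Theta -> 'M[C]_(a ^ n)}) : 'M[C]_(b ^ n * a ^ n) :=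
  tensmap id (D \o E) (canon_pur (rho ^t n)).

Definition lossy_protocol (R : realType) a b (rho : 'M[R[i]]_b)
    (N : {linear 'M[R[i]]_a -> 'M[R[i]]_b}) n Theta (eps : R)
    (E : {linear 'M[R[i]]_(b ^ n) -> 'M[R[i]]_Theta})
    (D : {linear 'M[R[i]]_Theta -> 'M[R[i]]_(a ^ n)}) : Prop :=
  let omega := protocol_output rho E D in
  [/\ cptp E, cptp D &
      trdist omega (tensmap (ntensmap N n) id (canon_pur (ptrace1 omega)))
        <= eps].
Arguments lossy_protocol {R a b} rho N n Theta eps E D.

Definition covering_code (R : realType) a b (rhoR : 'M[R[i]]_b)
    (N : {linear 'M[R[i]]_a -> 'M[R[i]]_b}) n Theta (eps : R)
    (sigma : 'M[R[i]]_(a ^ n)) : Prop :=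
  [/\ density sigma, \rank sigma = Theta &
      trdist (rhoR ^t n) (ntensmap N n sigma) <= eps].
Arguments covering_code {R a b} rhoR N n Theta eps sigma.

(* Main.v *)
Require Import Defs.
From HB Require Import structures.
From mathcomp Require Import all_boot all_order all_algebra.
From mathcomp Require Import reals complex mxtens.
From mathcomp Require Import ring lra.

(* Proof idea.  Operators X : C^p -> C^q are identified with bipartite vectors
   vec X = (1 (x) X)|Gamma>, and channels are handled through Kraus operators.

   (1) The covering state is the transpose of the A-marginal of omega; tracing
   out A^n in the protocol condition yields the covering condition, and the
   trace norm does not increase.

   (2) Let P = rho^(x)n, tau = sigma^T, let K_k be Kraus operators of N^(x)n and
   let V be an isometry onto the support of tau.  The vectors of
   (N^(x)n (x) id)(Psi_tau) are vec (sqrt tau K_k^T), and the operators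
   Y_k = V^H sqrt tau K_k^T satisfy sum_k Y_k^H Y_k = Q := (N^(x)n sigma)^T, so the
   polar decomposition Y_k = L_k sqrt Q provides the Kraus operators L_k of an
   encoder; V is the decoder.  Replacing sqrt Q by sqrt P costs
   |sqrt P - sqrt Q|_2^2 <= |P - Q|_1 <= 2 eps by Powers-Stormer.  In particular
   omega is O(sqrt eps)-close to (N^(x)n (x) id)(Psi_tau).  To replace tau by the
   marginal omega_A without a further loss of a square root, one does not use
   Powers-Stormer again but Tr (sqrt tau sqrt omega_A) >= F(tau, omega_A)^2. *)

Set Implicit Arguments.
Unset Strict Implicit.
Unset Printing Implicit Defensive.

Import Order.TTheory GRing.Theory Num.Theory.
Local Open Scope ring_scope.

Local Notation "A ^H" := (adjmx A) (at level 8, format "A ^H") : ring_scope.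

(** * Adjoints and positive semidefinite matrices *)

Section Adjoint.
Context {C : numClosedFieldType}.

Lemma adjmxE m n (A : 'M[C]_(m, n)) i j : A^H i j = (A j i)^*.
Proof. by rewrite !mxE. Qed.

Lemma adjmxK m n (A : 'M[C]_(m, n)) : A^H^H = A.
Proof. by apply/matrixP=> i j; rewrite !adjmxE conjCK. Qed.

Lemma adjmxM m n p (A : 'M[C]_(m, n)) (B : 'M[C]_(n, p)) :
  (A *m B)^H = B^H *m A^H.
Proof. by rewrite /adjmx trmx_mul map_mxM. Qed.

Lemma adjmxD m n (A B : 'M[C]_(m, n)) : (A + B)^H = A^H + B^H.
Proof. by rewrite /adjmx linearD map_mxD. Qed.

Lemma adjmxB m n (A B : 'M[C]_(m, n)) : (A - B)^H = A^H - B^H.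
Proof. by rewrite /adjmx linearB map_mxB. Qed.

Lemma adjmxZ m n c (A : 'M[C]_(m, n)) : (c *: A)^H = c^* *: A^H.
Proof. by apply/matrixP=> i j; rewrite !mxE rmorphM. Qed.

Lemma adjmx_sum m n I (r : seq I) (P : pred I) (F : I -> 'M[C]_(m, n)) :
  (\sum_(i <- r | P i) F i)^H = \sum_(i <- r | P i) (F i)^H.
Proof.
elim/big_rec2: _ => [|i y1 y2 _ <-]; last by rewrite adjmxD.
by apply/matrixP=> i j; rewrite !mxE rmorph0.
Qed.

Lemma adjmx1 n : (1%:M : 'M[C]_n)^H = 1%:M.
Proof. by rewrite /adjmx trmx1 map_mx1. Qed.

Lemma adjmx_tr m n (A : 'M[C]_(m, n)) : A^T^H = A^H^T.
Proof. by apply/matrixP=> i j; rewrite !mxE. Qed.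

Lemma adjmx_tens m n p q (A : 'M[C]_(m, n)) (B : 'M[C]_(p, q)) :
  (A *t B)^H = A^H *t B^H.
Proof. by apply/matrixP=> i j; rewrite !mxE rmorphM. Qed.

Lemma mxtrace_adj n (A : 'M[C]_n) : \tr A^H = (\tr A)^*.
Proof. by rewrite /mxtrace rmorph_sum; apply: eq_bigr => i _; rewrite adjmxE. Qed.

Lemma mxtrace_gramE m n (A : 'M[C]_(m, n)) :
  \tr (A^H *m A) = \sum_i \sum_j `|A j i| ^+ 2.
Proof.
apply: eq_bigr => i _; rewrite mxE; apply: eq_bigr => j _.
by rewrite adjmxE mulrC normCK.
Qed.

Lemma mxtrace_gram_ge0 m n (A : 'M[C]_(m, n)) : 0 <= \tr (A^H *m A).
Proof.
by rewrite mxtrace_gramE; do 2![apply: sumr_ge0 => ? _]; rewrite exprn_ge0.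
Qed.

Lemma mxtrace_gram_eq0 m n (A : 'M[C]_(m, n)) : \tr (A^H *m A) = 0 -> A = 0.
Proof.
rewrite mxtrace_gramE => /eqP; rewrite psumr_eq0 => [/allP h|? _]; last first.
  by apply: sumr_ge0 => ? _; rewrite exprn_ge0.
apply/matrixP => j i; rewrite mxE.
move: (h i (mem_index_enum _)) => /=.
rewrite psumr_eq0 => [/allP/(_ j (mem_index_enum _))/=|? _]; last first.
  by rewrite exprn_ge0.
by rewrite expf_eq0 /= normr_eq0 => /eqP.
Qed.

Lemma mx11_tr (A : 'M[C]_1) : A 0 0 = \tr A.
Proof. by rewrite /mxtrace big_ord1. Qed.

Lemma psdmx_gram m n (A : 'M[C]_(m, n)) : psdmx (A^H *m A).
Proof.
move=> v; rewrite mx11_tr.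
have -> : v^H *m (A^H *m A) *m v = (A *m v)^H *m (A *m v).
  by rewrite adjmxM !mulmxA.
exact: mxtrace_gram_ge0.
Qed.

Lemma psdmx_gramr m n (A : 'M[C]_(m, n)) : psdmx (A *m A^H).
Proof. by rewrite -[X in psdmx (X *m _)]adjmxK; apply: psdmx_gram. Qed.

Lemma psdmx_conj m n (A : 'M[C]_(m, n)) (X : 'M[C]_n) :
  psdmx X -> psdmx (A *m X *m A^H).
Proof.
move=> hX v; have := hX (A^H *m v).
by rewrite adjmxM adjmxK !mulmxA.
Qed.

Lemma psdmxD n (A B : 'M[C]_n) : psdmx A -> psdmx B -> psdmx (A + B).
Proof.
move=> hA hB v; rewrite mulmxDr mulmxDl mxE.
by apply: addr_ge0; [apply: hA | apply: hB].
Qed.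

Lemma psdmx0 n : psdmx (0 : 'M[C]_n).
Proof. by move=> v; rewrite mulmx0 mul0mx mxE. Qed.

Lemma psdmx_sum n I (r : seq I) (P : pred I) (F : I -> 'M[C]_n) :
  (forall i, psdmx (F i)) -> psdmx (\sum_(i <- r | P i) F i).
Proof.
by move=> h; elim/big_rec: _ => [|i X _]; [exact: psdmx0 | exact: psdmxD].
Qed.

Lemma psdmx_tr n (A : 'M[C]_n) : psdmx A -> psdmx A^T.
Proof.
move=> hA v; have := hA (map_mx Num.conj v); rewrite !mx11_tr.
rewrite -[\tr (_^H *m A^T *m _)]mxtrace_tr !trmx_mul trmxK mulmxA.
suff -> : v^T = (map_mx Num.conj v)^H.
  suff -> : v^H^T = map_mx Num.conj v by [].
  by apply/matrixP => i j; rewrite !mxE.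
by apply/matrixP => i j; rewrite !mxE conjCK.
Qed.

(** Polarization: with [x] and [y] the traces of [u^H H v] and [v^H H u], the vector [u + v] gives
    [x + y = 0] and [u + 'i v] gives [x - y = 0]. Basis vectors then read off each entry of [H].
    This is what makes psd matrices Hermitian. *)
Lemma form_eq0 n (H : 'M[C]_n) :
  (forall v : 'cV[C]_n, (v^H *m H *m v) 0 0 = 0) -> H = 0.
Proof.
move=> h.
have polar (u v : 'cV[C]_n) : \tr (u^H *m H *m v) = 0.
  have e1 := h (u + v); have e2 := h (u + 'i *: v).
  have eu := h u; have ev := h v.
  move: e1 e2 eu ev; rewrite !mx11_tr !adjmxD adjmxZ.
  rewrite !mulmxDl !mulmxDr -!scalemxAl -!scalemxAr !linearD /= !linearZ /=.
  rewrite conjCi.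
  set x := \tr (u^H *m H *m v); set y := \tr (v^H *m H *m u).
  move=> + + eu ev; rewrite eu ev !mulr0 !(add0r, addr0).
  move=> e1 e2.
  have e3 : x = - y by apply/eqP; rewrite -addr_eq0 e1.
  move: e2; rewrite e3 => /eqP.
  rewrite mulrN mulNr -opprD oppr_eq0 -mulr2n -mulrnAl mulf_eq0 mulrn_eq0 /=.
  by rewrite (negPf (neq0Ci _)) /= => /eqP->; rewrite oppr0.
apply/matrixP => i j.
have := polar (delta_mx i 0) (delta_mx j 0); rewrite -mx11_tr.
have -> : (delta_mx i 0 : 'cV[C]_n)^H = delta_mx 0 i.
  by apply/matrixP => a b; rewrite !mxE andbC; case: (_ && _); rewrite (rmorph0, rmorph1).
by rewrite -rowE -colE !mxE.
Qed.

Lemma psdmx_herm n (A : 'M[C]_n) : psdmx A -> A^H = A.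
Proof.
move=> hA; apply/esym/eqP; rewrite -subr_eq0; apply/eqP/form_eq0 => v.
rewrite mulmxBr mulmxBl mxE [X in _ + X]mxE.
have /CrealP e : (v^H *m A *m v) 0 0 \is Num.real by apply/ger0_real/hA.
rewrite -[X in _ - X](_ : ((v^H *m A *m v)^H) 0 0 = _).
  by rewrite adjmxE e subrr.
by rewrite !adjmxM adjmxK mulmxA.
Qed.

Lemma herm_normal n (A : 'M[C]_n) : A^H = A -> A \is normalmx.
Proof. by move=> hA; apply/normalmxP; change (A *m A^H = A^H *m A); rewrite hA. Qed.

End Adjoint.

(** * Functional calculus of normal matrices: roots, pseudo-inverses, supports *)

Section FunctionalCalculus.
Context {C : numClosedFieldType}.

Definition fcalc d (f : C -> C) (X : 'M[C]_d) : 'M[C]_d :=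
  invmx (spectralmx X) *m diag_mx (map_mx f (spectral_diag X)) *m spectralmx X.

Lemma sqrtmxE d (X : 'M[C]_d) : sqrtmx X = fcalc sqrtC X.
Proof. by []. Qed.

Lemma invmx_spectral d (X : 'M[C]_d) : invmx (spectralmx X) = (spectralmx X)^H.
Proof. exact/invmx_unitary/spectral_unitarymx. Qed.

Lemma eq_fcalc_spec d (f g : C -> C) (X : 'M[C]_d) :
  (forall i, f (spectral_diag X 0 i) = g (spectral_diag X 0 i)) ->
  fcalc f X = fcalc g X.
Proof.
move=> h; rewrite /fcalc; congr (_ *m diag_mx _ *m _).
by apply/rowP => i; rewrite !mxE.
Qed.

Lemma fcalcM d (f g : C -> C) (X : 'M[C]_d) :
  fcalc f X *m fcalc g X = fcalc (fun x => f x * g x) X.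
Proof.
rewrite /fcalc !mulmxA mulmxK ?spectral_unit //.
rewrite -!mulmxA; congr (_ *m _); rewrite !mulmxA; congr (_ *m _).
by rewrite mulmx_diag; congr diag_mx; apply/rowP => i; rewrite !mxE.
Qed.

Lemma fcalcD d (f g : C -> C) (X : 'M[C]_d) :
  fcalc f X + fcalc g X = fcalc (fun x => f x + g x) X.
Proof.
rewrite /fcalc -mulmxDl -mulmxDr -raddfD /=; congr (_ *m diag_mx _ *m _).
by apply/rowP => i; rewrite !mxE.
Qed.

Lemma fcalc_adj d (f : C -> C) (X : 'M[C]_d) :
  (fcalc f X)^H = fcalc (fun x => (f x)^*) X.
Proof.
rewrite /fcalc invmx_spectral !adjmxM adjmxK !mulmxA; congr (_ *m _ *m _).
by apply/matrixP => i j; rewrite !mxE rmorphMn /= eq_sym; case: eqP => // ->.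
Qed.

Lemma fcalc_id d (X : 'M[C]_d) : X \is normalmx -> fcalc id X = X.
Proof.
move=> /orthomx_spectralP {2}->; rewrite /fcalc; congr (_ *m diag_mx _ *m _).
by apply/rowP => i; rewrite !mxE.
Qed.

Lemma spectral_diagE d (X : 'M[C]_d) : X \is normalmx ->
  diag_mx (spectral_diag X) = spectralmx X *m X *m (spectralmx X)^H.
Proof.
move=> /orthomx_spectralP {3}->.
by rewrite -invmx_spectral !mulmxA mulmxV ?spectral_unit // mul1mx mulmxK
  ?spectral_unit.
Qed.

Lemma psdmx_diag_ge0 d (X : 'M[C]_d) i : psdmx X -> 0 <= X i i.
Proof.
move=> /(_ (delta_mx i 0)).
have -> : (delta_mx i 0 : 'cV[C]_d)^H = delta_mx 0 i.
  by apply/matrixP => a b; rewrite !mxE andbC; case: (_ && _);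
    rewrite (rmorph0, rmorph1).
by rewrite -rowE -colE !mxE.
Qed.

Lemma psdmx_spectral d (X : 'M[C]_d) i : psdmx X -> 0 <= spectral_diag X 0 i.
Proof.
move=> hX; have hn := herm_normal (psdmx_herm hX).
have := psdmx_diag_ge0 i (psdmx_conj (spectralmx X) hX).
by rewrite -spectral_diagE // mxE eqxx.
Qed.

Lemma herm_spectral_real d (X : 'M[C]_d) i :
  X^H = X -> spectral_diag X 0 i \is Num.real.
Proof.
move=> hX; have hn := herm_normal hX.
have : (spectralmx X *m X *m (spectralmx X)^H)^H
     = spectralmx X *m X *m (spectralmx X)^H.
  by rewrite !adjmxM adjmxK hX mulmxA.
rewrite -spectral_diagE // => /matrixP/(_ i i).
by rewrite adjmxE mxE eqxx mulr1n => h; apply/CrealP.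
Qed.

Lemma eq_fcalc_psd d (f g : C -> C) (X : 'M[C]_d) : psdmx X ->
  (forall x, 0 <= x -> f x = g x) -> fcalc f X = fcalc g X.
Proof. by move=> hX h; apply: eq_fcalc_spec => i; exact/h/psdmx_spectral. Qed.

Lemma eq_fcalc_herm d (f g : C -> C) (X : 'M[C]_d) : X^H = X ->
  (forall x, x \is Num.real -> f x = g x) -> fcalc f X = fcalc g X.
Proof. by move=> hX h; apply: eq_fcalc_spec => i; exact/h/herm_spectral_real. Qed.

Lemma fcalc_psd_spec d (f : C -> C) (X : 'M[C]_d) :
  (forall i, 0 <= f (spectral_diag X 0 i)) -> psdmx (fcalc f X).
Proof.
move=> h; rewrite (@eq_fcalc_spec _ f (fun x => (sqrtC (f x))^* * sqrtC (f x))).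
  by rewrite -fcalcM -fcalc_adj; exact: psdmx_gram.
move=> i; have e : 0 <= sqrtC (f (spectral_diag X 0 i)) by rewrite sqrtC_ge0.
by rewrite (CrealP (ger0_real e)) -expr2 sqrtCK.
Qed.

Lemma fcalc_psd d (f : C -> C) (X : 'M[C]_d) : psdmx X ->
  (forall x, 0 <= x -> 0 <= f x) -> psdmx (fcalc f X).
Proof. by move=> hX h; apply: fcalc_psd_spec => i; exact/h/psdmx_spectral. Qed.

Lemma fcalc_psd_herm d (f : C -> C) (X : 'M[C]_d) : X^H = X ->
  (forall x, x \is Num.real -> 0 <= f x) -> psdmx (fcalc f X).
Proof.
by move=> hX h; apply: fcalc_psd_spec => i; exact/h/herm_spectral_real.
Qed.

Lemma psdmx_sqrt d (X : 'M[C]_d) : psdmx X -> psdmx (sqrtmx X).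
Proof. by move=> hX; apply: fcalc_psd => // x; rewrite sqrtC_ge0. Qed.

Lemma sqrtmxK d (X : 'M[C]_d) : psdmx X -> sqrtmx X *m sqrtmx X = X.
Proof.
move=> hX; rewrite !sqrtmxE fcalcM (@eq_fcalc_psd _ _ id) //.
  by apply: fcalc_id; exact/herm_normal/psdmx_herm.
by move=> x _; rewrite -expr2 sqrtCK.
Qed.

Lemma sqrtmx_herm d (X : 'M[C]_d) : psdmx X -> (sqrtmx X)^H = sqrtmx X.
Proof. by move=> /psdmx_sqrt/psdmx_herm. Qed.

(** Since the inverse of 0 is 0, for psd [X] the first is the Moore-Penrose inverse of the square
    root; the second is the orthogonal projection onto the support of [X]. *)
Definition invsqrtmx d (X : 'M[C]_d) := fcalc (fun x => (sqrtC x)^-1) X.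
Definition suppmx d (X : 'M[C]_d) := fcalc (fun x => (x != 0)%:R) X.

Lemma invsqrtmx_herm d (X : 'M[C]_d) :
  psdmx X -> (invsqrtmx X)^H = invsqrtmx X.
Proof.
move=> hX; apply/psdmx_herm/fcalc_psd => // x.
by rewrite invr_ge0 sqrtC_ge0.
Qed.

Lemma suppmx_herm d (X : 'M[C]_d) : (suppmx X)^H = suppmx X.
Proof. by rewrite fcalc_adj; apply: eq_fcalc_spec => i; rewrite conjC_nat. Qed.

Lemma suppmx_idem d (X : 'M[C]_d) : suppmx X *m suppmx X = suppmx X.
Proof.
by rewrite fcalcM; apply: eq_fcalc_spec => i; case: eqP; rewrite (mulr0, mulr1).
Qed.

Lemma sqrtmxVl d (X : 'M[C]_d) : sqrtmx X *m invsqrtmx X = suppmx X.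
Proof.
rewrite fcalcM; apply: eq_fcalc_spec => i; rewrite -sqrtC_eq0.
by have [->|h] := eqVneq (sqrtC _) 0; rewrite ?mul0r ?divff.
Qed.

Lemma sqrtmxVr d (X : 'M[C]_d) : invsqrtmx X *m sqrtmx X = suppmx X.
Proof.
by rewrite -sqrtmxVl !fcalcM; apply: eq_fcalc_spec => i; rewrite mulrC.
Qed.

Lemma suppmx_sqrt d (X : 'M[C]_d) : suppmx X *m sqrtmx X = sqrtmx X.
Proof.
rewrite fcalcM; apply: eq_fcalc_spec => i; rewrite -sqrtC_eq0.
by have [->|h] := eqVneq (sqrtC _) 0; rewrite ?mulr0 ?mul1r.
Qed.

Lemma sqrtmx_supp d (X : 'M[C]_d) : sqrtmx X *m suppmx X = sqrtmx X.
Proof.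
by rewrite -[in RHS]suppmx_sqrt !fcalcM; apply: eq_fcalc_spec => i; rewrite mulrC.
Qed.

Lemma suppmxK d (X : 'M[C]_d) : psdmx X -> suppmx X *m X = X.
Proof. by move=> hX; rewrite -[X in _ *m X]sqrtmxK // mulmxA suppmx_sqrt sqrtmxK. Qed.

Lemma mxtrace_psd_ge0 d (X : 'M[C]_d) : psdmx X -> 0 <= \tr X.
Proof. by move=> hX; apply: sumr_ge0 => i _; exact: psdmx_diag_ge0. Qed.

Lemma mxtrace_psdM_ge0 d (X Y : 'M[C]_d) :
  psdmx X -> psdmx Y -> 0 <= \tr (X *m Y).
Proof.
move=> hX hY; rewrite -[X]sqrtmxK // -mulmxA mxtrace_mulC.
have := mxtrace_psd_ge0 (psdmx_conj (sqrtmx X) hY).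
by rewrite sqrtmx_herm.
Qed.

End FunctionalCalculus.

(** * Supports of sums of Gram matrices *)

Section GramSupport.
Context {C : numClosedFieldType}.

(** The Gram matrices of [Y i (1 - P)] add up to [(1 - P) Q (1 - P) = 0]. Their traces are
    nonnegative, so each of them vanishes, and with it each [Y i (1 - P)]. *)
Lemma gram_absorb m d (I : finType) (Y : I -> 'M[C]_(m, d)) (P Q : 'M[C]_d) k :
  Q = \sum_i (Y i)^H *m Y i -> P^H = P -> P *m Q = Q -> Y k *m P = Y k.
Proof.
move=> defQ hP PQ; pose Z i := Y i *m (1%:M - P).
have sZ : \sum_i \tr ((Z i)^H *m Z i) = 0.
  have -> : \sum_i \tr ((Z i)^H *m Z i) = \tr ((1%:M - P) *m Q *m (1%:M - P)).
    rewrite defQ mulmx_sumr mulmx_suml raddf_sum /=; apply: eq_bigr => i _.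
    by rewrite adjmxM adjmxB adjmx1 hP !mulmxA.
  by rewrite mulmxBl mul1mx PQ subrr mul0mx mxtrace0.
have /mxtrace_gram_eq0 : \tr ((Z k)^H *m Z k) = 0.
  move/eqP: sZ; rewrite psumr_eq0 => [/allP/(_ k (mem_index_enum _))/eqP//|i _].
  exact: mxtrace_gram_ge0.
by rewrite /Z mulmxBr mulmx1 => /eqP; rewrite subr_eq0 => /eqP.
Qed.

Lemma gram_supp m d (I : finType) (Y : I -> 'M[C]_(m, d)) (Q : 'M[C]_d) k :
  Q = \sum_i (Y i)^H *m Y i -> Y k *m suppmx Q = Y k.
Proof.
move=> defQ; apply: gram_absorb (defQ) (suppmx_herm _) _; apply: suppmxK.
by rewrite defQ; apply: psdmx_sum => i; exact: psdmx_gram.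
Qed.

Lemma invsqrtmxK d (Q : 'M[C]_d) : psdmx Q ->
  invsqrtmx Q *m Q *m invsqrtmx Q = suppmx Q.
Proof.
move=> hQ; rewrite -[X in _ *m X *m _]sqrtmxK // mulmxA sqrtmxVr -mulmxA sqrtmxVl.
exact: suppmx_idem.
Qed.

Lemma invsqrtmx_supp d (Q : 'M[C]_d) : invsqrtmx Q *m suppmx Q = invsqrtmx Q.
Proof.
rewrite fcalcM; apply: eq_fcalc_spec => i.
by case: eqP => [->|_]; rewrite ?sqrtC0 ?invr0 ?mul0r ?mulr1.
Qed.

End GramSupport.

Local Opaque sqrtmx invsqrtmx suppmx.

(** * The real Hilbert-Schmidt inner product and contractions *)

Section RealTrace.
Context {R : realType}.
Local Notation C := R[i].

Definition rtr d (X : 'M[C]_d) : R := complex.Re (\tr X).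

Lemma ReD (x y : C) : complex.Re (x + y) = complex.Re x + complex.Re y.
Proof. by case: x y => [a b] [c d]. Qed.

Lemma ReN (x : C) : complex.Re (- x) = - complex.Re x.
Proof. by case: x. Qed.

Lemma Re_conj (x : C) : complex.Re (x^*)%R = complex.Re x.
Proof. by case: x. Qed.

Lemma Re_ge0 (x : C) : 0 <= x -> 0 <= complex.Re x.
Proof. by case: x => a b; rewrite lecE => /andP[]. Qed.

Lemma rtrD d (X Y : 'M[C]_d) : rtr (X + Y) = rtr X + rtr Y.
Proof. by rewrite /rtr mxtraceD ReD. Qed.

Lemma rtrN d (X : 'M[C]_d) : rtr (- X) = - rtr X.
Proof. by rewrite /rtr raddfN /= ReN. Qed.

Lemma rtrB d (X Y : 'M[C]_d) : rtr (X - Y) = rtr X - rtr Y.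
Proof. by rewrite rtrD rtrN. Qed.

Lemma rtr_sum d I (r : seq I) (P : pred I) (F : I -> 'M[C]_d) :
  rtr (\sum_(i <- r | P i) F i) = \sum_(i <- r | P i) rtr (F i).
Proof. by apply: (big_morph _ (@rtrD d)); rewrite /rtr mxtrace0. Qed.

Lemma rtrZ d (t : R) (X : 'M[C]_d) : rtr (t%:C%C *: X) = t * rtr X.
Proof.
by rewrite /rtr mxtraceZ; case: (\tr X) => a b /=; rewrite mul0r subr0.
Qed.

Lemma rtr_mulC m n (X : 'M[C]_(m, n)) (Y : 'M[C]_(n, m)) :
  rtr (X *m Y) = rtr (Y *m X).
Proof. by rewrite /rtr mxtrace_mulC. Qed.

Lemma rtr_adj d (X : 'M[C]_d) : rtr X^H = rtr X.
Proof. by rewrite /rtr mxtrace_adj Re_conj. Qed.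

Lemma rtr_tr d (X : 'M[C]_d) : rtr X^T = rtr X.
Proof. by rewrite /rtr mxtrace_tr. Qed.

(** Real part of the Hilbert-Schmidt inner product. Taking the real part makes it symmetric, so that
    the estimates become real arithmetic; [sq] is the squared Hilbert-Schmidt norm. *)
Definition ip m n (A B : 'M[C]_(m, n)) : R := rtr (A^H *m B).
Local Notation sq A := (ip A A).

Lemma ipC m n (A B : 'M[C]_(m, n)) : ip A B = ip B A.
Proof. by rewrite /ip -rtr_adj adjmxM adjmxK. Qed.

Lemma ipDr m n (A B D : 'M[C]_(m, n)) : ip A (B + D) = ip A B + ip A D.
Proof. by rewrite /ip mulmxDr rtrD. Qed.

Lemma ipDl m n (A B D : 'M[C]_(m, n)) : ip (A + B) D = ip A D + ip B D.
Proof. by rewrite ![ip _ D]ipC ipDr. Qed.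

Lemma ipNr m n (A B : 'M[C]_(m, n)) : ip A (- B) = - ip A B.
Proof. by rewrite /ip mulmxN rtrN. Qed.

Lemma ipNl m n (A B : 'M[C]_(m, n)) : ip (- A) B = - ip A B.
Proof. by rewrite ipC ipNr ipC. Qed.

Lemma ipZr m n t (A B : 'M[C]_(m, n)) : ip A (t%:C%C *: B) = t * ip A B.
Proof. by rewrite /ip -scalemxAr rtrZ. Qed.

Lemma ipZl m n t (A B : 'M[C]_(m, n)) : ip (t%:C%C *: A) B = t * ip A B.
Proof. by rewrite ipC ipZr ipC. Qed.

Lemma ip_sumr m n I (r : seq I) (P : pred I) (A : 'M[C]_(m, n)) F :
  ip A (\sum_(i <- r | P i) F i) = \sum_(i <- r | P i) ip A (F i).
Proof. by rewrite /ip mulmx_sumr rtr_sum. Qed.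

Lemma ip_mull m n p (A : 'M[C]_(m, n)) (B : 'M[C]_(m, p)) (D : 'M[C]_(n, p)) :
  ip (A *m D) B = ip D (A^H *m B).
Proof. by rewrite /ip adjmxM mulmxA. Qed.

Lemma sq_ge0 m n (A : 'M[C]_(m, n)) : 0 <= sq A.
Proof. exact/Re_ge0/mxtrace_gram_ge0. Qed.

Lemma sqB m n (A B : 'M[C]_(m, n)) : sq (A - B) = sq A + sq B - 2 * ip A B.
Proof.
by rewrite ipDr !ipDl !ipNr !ipNl opprK (ipC B A); ring.
Qed.

Lemma ip_amgm m n (A B : 'M[C]_(m, n)) : 2 * ip A B <= sq A + sq B.
Proof. by have := sq_ge0 (A - B); rewrite sqB; lra. Qed.

Lemma discr_le (a b c : R) :
  (forall t, 0 <= a * t ^+ 2 - 2 * b * t + c) -> b ^+ 2 <= a * c.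
Proof.
move=> h; have [a0|a0] := eqVneq a 0.
  have [->|b0] := eqVneq b 0; first by rewrite a0 mul0r expr0n.
  (* At this point the affine function takes the value -1. *)
  have := h ((c + 1) / (2 * b)); rewrite a0 mul0r add0r.
  suff -> : - (2 * b * ((c + 1) / (2 * b))) = - (c + 1) by lra.
  by field; rewrite b0.
have a_gt0 : 0 < a.
  have h0 := h 0.
  rewrite lt_neqAle eq_sym a0 /= leNgt; apply/negP => an.
  have c0 : 0 <= c by move: h0; rewrite expr0n /= !mulr0; lra.
  (* For [a < 0] this is a root of the polynomial plus 1, so the polynomial takes the value -1
     there; [0 <= c] makes the radicand nonnegative. *)
  have := h ((b + Num.sqrt (b ^+ 2 - a * (c + 1))) / a).
  set s := Num.sqrt _.
  have hs : s ^+ 2 = b ^+ 2 - a * (c + 1).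
    by rewrite sqr_sqrtr //; have := sqr_ge0 b; nra.
  suff -> : a * ((b + s) / a) ^+ 2 - 2 * b * ((b + s) / a) + c = - 1 by lra.
  transitivity ((s ^+ 2 - b ^+ 2) / a + c); first by field.
  by rewrite hs; field.
have := h (b / a).
have -> : a * (b / a) ^+ 2 - 2 * b * (b / a) + c = c - b ^+ 2 / a by field.
by rewrite subr_ge0 ler_pdivrMr // mulrC.
Qed.

Lemma ip_cauchy (I : finType) m n (A B : I -> 'M[C]_(m, n)) :
  (\sum_i ip (A i) (B i)) ^+ 2 <= (\sum_i sq (A i)) * (\sum_i sq (B i)).
Proof.
apply: discr_le => t.
have -> : (\sum_i sq (A i)) * t ^+ 2 - 2 * (\sum_i ip (A i) (B i)) * t
    + \sum_i sq (B i) = \sum_i sq (t%:C%C *: A i - B i).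
  rewrite mulr_suml mulr_sumr mulr_suml -sumrN -!big_split /=.
  by apply: eq_bigr => i _; rewrite sqB !ipZl !ipZr; ring.
by apply: sumr_ge0 => i _; exact: sq_ge0.
Qed.

Lemma ip_cauchy_sqrt (I : finType) m n (A B : I -> 'M[C]_(m, n)) :
  \sum_i ip (A i) (B i)
  <= Num.sqrt (\sum_i sq (A i)) * Num.sqrt (\sum_i sq (B i)).
Proof.
rewrite -sqrtrM; last by apply: sumr_ge0 => i _; exact: sq_ge0.
apply: le_trans (ler_norm _) _; rewrite -sqrtr_sqr.
exact/ler_wsqrtr/ip_cauchy.
Qed.

(** Operator norm at most 1, expressed through the Hilbert-Schmidt norm on blocks with any number of
    columns. *)
Definition contraction m n (G : 'M[C]_(m, n)) : Prop :=
  forall p (A : 'M[C]_(n, p)), sq (G *m A) <= sq A.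

Lemma contractionM m n p (G : 'M[C]_(m, n)) (W : 'M[C]_(n, p)) :
  contraction G -> contraction W -> contraction (G *m W).
Proof.
by move=> hG hW q A; rewrite -mulmxA; exact: le_trans (hG _ _) (hW _ _).
Qed.

(** Here [2 |G^H A|^2 = 2 <A, G G^H A> <= |A|^2 + |G G^H A|^2 <= |A|^2 + |G^H A|^2]. *)
Lemma contraction_adj m n (G : 'M[C]_(m, n)) :
  contraction G -> contraction G^H.
Proof.
move=> hG p A; have := ip_amgm A (G *m (G^H *m A)).
have -> : ip A (G *m (G^H *m A)) = sq (G^H *m A) by rewrite ipC ip_mull.
by have := hG _ (G^H *m A); lra.
Qed.

Lemma contraction_tr m n (G : 'M[C]_(m, n)) :
  contraction G -> contraction G^T.
Proof.
move=> /contraction_adj hG p A.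
have sq_conj a b (M : 'M[C]_(a, b)) : sq (map_mx Num.conj M) = sq M.
  rewrite /ip -[RHS]rtr_tr trmx_mul; congr (rtr (_ *m _)).
    by apply/matrixP=> i j; rewrite !mxE conjCK.
  by apply/matrixP=> i j; rewrite !mxE.
rewrite -sq_conj -[leRHS]sq_conj map_mxM /=.
have -> : map_mx Num.conj G^T = G^H by [].
exact: hG.
Qed.

(** For a partial isometry [W^H W] is an orthogonal projection, and Pythagoras gives
    [|A|^2 - |W A|^2 = |A - W^H W A|^2]. *)
Lemma contraction_pisom m n (W : 'M[C]_(m, n)) :
  W *m W^H *m W = W -> contraction W.
Proof.
move=> hW p A; rewrite -subr_ge0.
suff -> : sq A - sq (W *m A) = sq (A - W^H *m (W *m A)) by exact: sq_ge0.
rewrite sqB [ip A (_ *m _)]ipC !ip_mull adjmxK.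
have -> : W *m (W^H *m (W *m A)) = W *m A by rewrite !mulmxA hW.
by rewrite -ip_mull; ring.
Qed.

(** * The trace norm by duality with contractions *)

Section TraceNorm.
Context {d : nat}.
Implicit Types G H : 'M[C]_d.

(** Polar decomposition, with [W] the partial isometry obtained by multiplying [H] by the
    pseudo-inverse of its absolute value. *)
Lemma trnorm_polar H : exists W : 'M[C]_d,
  [/\ contraction W, W *m sqrtmx (H^H *m H) = H &
      W^H *m H = sqrtmx (H^H *m H)].
Proof.
set M := H^H *m H; have hM : psdmx M by exact: psdmx_gram.
have HS : H *m suppmx M = H.
  by apply: (@gram_supp _ _ _ 'I_1 (fun _ => H) _ 0); rewrite big_ord1.
exists (H *m invsqrtmx M); split.
- apply: contraction_pisom; rewrite adjmxM invsqrtmx_herm //.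
  transitivity (H *m (invsqrtmx M *m (invsqrtmx M *m M *m invsqrtmx M))).
    by move: (invsqrtmx M) => q; rewrite /M !mulmxA.
  by rewrite invsqrtmxK // invsqrtmx_supp.
- by rewrite -mulmxA sqrtmxVr.
- rewrite adjmxM invsqrtmx_herm // -mulmxA -/M -[X in _ *m X]sqrtmxK //.
  by rewrite mulmxA sqrtmxVr suppmx_sqrt.
Qed.

(** Together with [trnorm_ge] this is the variational formula: the trace norm is the maximum of Re
    Tr [G H] over contractions [G]. The triangle inequality and the behaviour under transposition
    and channels follow from it. *)
Lemma trnorm_attained H : exists2 G, contraction G & rtr (G *m H) = trnorm H.
Proof.
have [W [hW _ WH]] := trnorm_polar H.
by exists W^H; [exact: contraction_adj | rewrite WH].
Qed.

(** Write [H = W T T] with [T] the square root of the absolute value of [H]. Then Re Tr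
    [G H = <T, G W T>], which is at most [|T|^2] because [G W] is a contraction. *)
Lemma trnorm_ge G H : contraction G -> rtr (G *m H) <= trnorm H.
Proof.
move=> hG; have [W [hW WS _]] := trnorm_polar H.
set S := sqrtmx _ in WS; pose T := sqrtmx S.
have hS : psdmx S by apply/psdmx_sqrt/psdmx_gram.
have TT : T *m T = S by exact: sqrtmxK.
have hT : T^H = T by exact: sqrtmx_herm.
have -> : trnorm H = sq T by rewrite /ip hT TT.
have -> : rtr (G *m H) = ip T (G *m W *m T).
  by rewrite /ip hT [RHS]rtr_mulC -[in LHS]WS -TT !mulmxA.
have := ip_amgm T (G *m W *m T).
have := contractionM hG hW T.
by move: (sq (G *m W *m T)) (ip T (G *m W *m T)) (sq T) => a b c; lra.
Qed.

Lemma trnorm_le H a : (forall G, contraction G -> rtr (G *m H) <= a) ->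
  trnorm H <= a.
Proof. by have [G hG <-] := trnorm_attained H; apply. Qed.

Lemma trnormD H1 H2 : trnorm (H1 + H2) <= trnorm H1 + trnorm H2.
Proof.
by apply: trnorm_le => G hG; rewrite mulmxDr rtrD lerD ?trnorm_ge.
Qed.

Lemma trnorm_tr_le H : trnorm H^T <= trnorm H.
Proof.
apply: trnorm_le => G hG; rewrite -rtr_tr trmx_mul trmxK rtr_mulC.
exact/trnorm_ge/contraction_tr.
Qed.

(** Split [x x^H - y y^H = (x - y) x^H + y (x - y)^H], test against a contraction and apply
    Cauchy-Schwarz over the whole family to both terms. *)
Lemma trnorm_gram (I : finType) m (x y : I -> 'M[C]_(d, m)) :
  \sum_i sq (x i) <= 1 -> \sum_i sq (y i) <= 1 ->
  trnorm (\sum_i x i *m (x i)^H - \sum_i y i *m (y i)^H)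
  <= 2 * Num.sqrt (\sum_i sq (x i - y i)).
Proof.
move=> hx hy; apply: trnorm_le => G hG.
have -> : rtr (G *m (\sum_i x i *m (x i)^H - \sum_i y i *m (y i)^H))
  = \sum_i ip (x i) (G *m (x i - y i)) + \sum_i ip (x i - y i) (G *m y i).
  rewrite -sumrB mulmx_sumr rtr_sum -big_split /=; apply: eq_bigr => i _.
  rewrite /ip [rtr ((x i)^H *m _)]rtr_mulC [rtr ((_ - _)^H *m _)]rtr_mulC -rtrD.
  congr rtr; rewrite !mulmxBr adjmxB mulmxBl mulmxBr !mulmxA.
  by rewrite addrA subrK.
have bnd (u v : I -> 'M[C]_(d, m)) :
    \sum_i ip (u i) (G *m v i)
    <= Num.sqrt (\sum_i sq (u i)) * Num.sqrt (\sum_i sq (v i)).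
  apply: le_trans (ip_cauchy_sqrt _ _) _.
  apply: ler_wpM2l; first exact: sqrtr_ge0.
  by apply: ler_wsqrtr; apply: ler_sum => i _; exact: hG.
have sq1 (u : I -> 'M[C]_(d, m)) :
    \sum_i sq (u i) <= 1 -> Num.sqrt (\sum_i sq (u i)) <= 1.
  by move=> hu; rewrite -sqrtr1; exact: ler_wsqrtr.
have b1 := bnd x (fun i => x i - y i); have b2 := bnd (fun i => x i - y i) y.
have s1 := sq1 _ hx; have s2 := sq1 _ hy.
have s0 := sqrtr_ge0 (\sum_i sq (x i - y i)).
by nra.
Qed.

End TraceNorm.

Lemma trnorm_tr d (H : 'M[C]_d) : trnorm H^T = trnorm H.
Proof.
apply: le_anti; rewrite trnorm_tr_le /=.
by have := trnorm_tr_le H^T; rewrite trmxK.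
Qed.

(** By duality it suffices that the adjoint map sends a contraction [G] to a contraction. For
    [Z = sum_i K_i^H G K_i A] one has [2 |Z|^2 = 2 sum_i <K_i Z, G K_i A> <= |Z|^2 + |A|^2], since
    the [K_i] together form an isometry. *)
Lemma trnorm_kraus p q (I : finType) (K : I -> 'M[C]_(q, p)) (X : 'M[C]_p) :
  \sum_i (K i)^H *m K i = 1%:M ->
  trnorm (\sum_i K i *m X *m (K i)^H) <= trnorm X.
Proof.
move=> hK; apply: trnorm_le => G hG.
have -> : rtr (G *m (\sum_i K i *m X *m (K i)^H))
        = rtr ((\sum_i (K i)^H *m G *m K i) *m X).
  rewrite mulmx_sumr mulmx_suml !rtr_sum; apply: eq_bigr => i _.
  by rewrite !mulmxA rtr_mulC !mulmxA.
have isom m (A : 'M[C]_(p, m)) : \sum_i sq (K i *m A) = sq A.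
  rewrite [RHS]/ip -[A in rtr (_ *m A)]mul1mx -hK mulmx_suml mulmx_sumr rtr_sum.
  by apply: eq_bigr => i _; rewrite ip_mull /ip !mulmxA.
apply: trnorm_ge => m A.
set Z := _ *m A.
have ZE : Z = \sum_i (K i)^H *m (G *m (K i *m A)).
  by rewrite /Z mulmx_suml; apply: eq_bigr => i _; rewrite !mulmxA.
have : 2 * sq Z <= \sum_i (sq (K i *m Z) + sq (G *m (K i *m A))).
  rewrite {2}ZE ip_sumr mulr_sumr; apply: ler_sum => i _.
  by rewrite -ip_mull; exact: ip_amgm.
rewrite big_split /= isom.
have : \sum_i sq (G *m (K i *m A)) <= sq A.
  by rewrite -[leRHS]isom; apply: ler_sum => i _; exact: hG.
by lra.
Qed.

End RealTrace.

Local Notation sq A := (ip A A).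

(** * Powers-Stormer, affinity, and the polar form of Kraus families *)

Section Fidelity.
Context {R : realType}.
Local Notation C := R[i].

Lemma mxtrace_psdM_Re d (X Y : 'M[C]_d) : psdmx X -> psdmx Y ->
  0 <= rtr (X *m Y).
Proof. by move=> hX hY; exact/Re_ge0/mxtrace_psdM_ge0. Qed.

(* Powers-Stormer: with D = S - T and G = sgn D, the trace of G (S^2 - T^2)
   equals that of |D| (S + T), and |D| dominates both D and - D. *)
Lemma powers_stormer d (S T : 'M[C]_d) : psdmx S -> psdmx T ->
  sq (S - T) <= trnorm (S *m S - T *m T).
Proof.
move=> hS hT; set D := S - T.
have hD : D^H = D by rewrite adjmxB !psdmx_herm.
have DE : fcalc id D = D by exact/fcalc_id/herm_normal.
pose G := fcalc Num.sg D; pose A := fcalc (fun x => `|x|) D.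
have sgM (x : C) : x \is Num.real -> Num.sg x * x = `|x|.
  move=> hx; case: (real_ltgt0P hx) => [h|h|->]; last by rewrite mulr0.
    by rewrite gtr0_sg // mul1r.
  by rewrite ltr0_sg // mulN1r.
have GD : G *m D = A.
  by rewrite -[in X in _ *m X]DE fcalcM; apply: eq_fcalc_herm.
have DG : D *m G = A.
  rewrite -[in X in X *m _]DE fcalcM; apply: eq_fcalc_herm => // x hx.
  by rewrite mulrC sgM.
(* The sign function satisfies [s * s * s = s], so [G] is a Hermitian partial isometry. *)
have hG : contraction G.
  apply: contraction_pisom; rewrite fcalc_adj !fcalcM.
  apply: eq_fcalc_herm => // x _; rewrite /Num.sg.
  by do 2?case: ifP => _; rewrite ?rmorph0 ?rmorph1 ?rmorphN1 ?mul0r ?mul1r ?mulrN1 ?opprK.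
have AmD : psdmx (A - D).
  rewrite -[in X in _ - X]DE.
  have -> : A - fcalc id D = fcalc (fun x => `|x| - x) D.
    apply/eqP; rewrite subr_eq fcalcD; apply/eqP/eq_fcalc_spec => i.
    by rewrite subrK.
  by apply: fcalc_psd_herm => // x hx; rewrite subr_ge0 real_ler_norm.
have ApD : psdmx (A + D).
  rewrite -[in X in _ + X]DE fcalcD.
  apply: fcalc_psd_herm => // x hx.
  by rewrite -[X in _ + X]opprK subr_ge0 -normrN real_ler_norm ?realN.
clearbody G A.
have e1 := trnorm_ge (S *m S - T *m T) hG.
(* [S] and [T] need not commute, so the symmetrized identity [2 (S^2 - T^2) = D (S + T) + (S + T) D]
   is used; cyclicity and [G D = D G = A] give both terms the same trace. *)
have e2 : rtr (G *m (S *m S - T *m T)) + rtr (G *m (S *m S - T *m T))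
        = rtr (A *m (S + T)) + rtr (A *m (S + T)).
  have e : rtr (G *m (S + T) *m D) = rtr (A *m (S + T)).
    by rewrite rtr_mulC mulmxA DG.
  rewrite -{1}e -GD -!rtrD; congr rtr.
  rewrite -!mulmxA -!mulmxDr; congr (_ *m _).
  rewrite /D !mulmxDl !mulmxDr !mulNmx !mulmxN.
  move: (S *m S) (S *m T) (T *m S) (T *m T) => M1 M2 M3 M4.
  by apply/matrixP => i j; rewrite !mxE; ring.
(* The sum of these two traces is Tr [A (S + T)] minus [|D|^2]. *)
have e3 := mxtrace_psdM_Re AmD hS; have e4 := mxtrace_psdM_Re ApD hT.
have e5 : sq D = rtr (D *m S) - rtr (D *m T).
  by rewrite /ip hD -rtrB -mulmxBr.
move: e2 e3 e4; rewrite e5 (mulmxDr A) mulmxBl (mulmxDl A) rtrB !rtrD.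
move: e1; move: (rtr _) (trnorm _) (rtr (D *m S)) (rtr (D *m T)).
by move: (rtr (A *m S)) (rtr (A *m T)) => *; lra.
Qed.

(** Take [t = tau^(1/4)] and [Y' i = tau^(-1/4) Y i], with the pseudo-inverse. The projection onto
    the support of [sqrt tau] fixes every [Y i], and [tau^(-1/4) tau tau^(-1/4) = tau^(1/2)]. *)
Lemma gram_quarter e m (I : finType) (Y : I -> 'M[C]_(e, m)) (tau : 'M[C]_e) :
  tau = \sum_i Y i *m (Y i)^H ->
  exists t : 'M[C]_e, exists Y' : I -> 'M[C]_(e, m),
    [/\ t^H = t, t *m t = sqrtmx tau, forall i, Y i = t *m Y' i &
        \sum_i Y' i *m (Y' i)^H = sqrtmx tau].
Proof.
move=> deft.
have ht : psdmx tau by rewrite deft; apply: psdmx_sum => i; exact: psdmx_gramr.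
have hs := psdmx_sqrt ht.
have [t [ti [S [[tH tiH SH] [tt tti tit Ss tS]]]]] : exists t ti S : 'M[C]_e,
    [/\ t^H = t, ti^H = ti & S^H = S]
    /\ [/\ t *m t = sqrtmx tau, t *m ti = S, ti *m t = S,
           S *m sqrtmx tau = sqrtmx tau & t *m S = t].
  exists (sqrtmx (sqrtmx tau)), (invsqrtmx (sqrtmx tau)), (suppmx (sqrtmx tau)).
  split; split.
  - exact: sqrtmx_herm.
  - exact: invsqrtmx_herm.
  - exact: suppmx_herm.
  - exact: sqrtmxK.
  - exact: sqrtmxVl.
  - exact: sqrtmxVr.
  - exact: suppmxK.
  - exact: sqrtmx_supp.
have ss : sqrtmx tau *m sqrtmx tau = tau := sqrtmxK ht.
have St : S *m tau = tau by rewrite -ss mulmxA Ss.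
exists t, (fun i => ti *m Y i); split=> //.
- move=> i; rewrite mulmxA tti -[LHS]adjmxK.
  have <- : (Y i)^H *m S = (Y i)^H; last by rewrite adjmxM adjmxK SH.
  apply: (@gram_absorb _ _ _ _ (fun i => (Y i)^H) _ tau) => //.
  by rewrite deft; apply: eq_bigr => k _; rewrite adjmxK.
- transitivity (ti *m tau *m ti).
    rewrite deft mulmx_sumr mulmx_suml; apply: eq_bigr => i _.
    by rewrite adjmxM tiH !mulmxA.
  rewrite -[X in _ *m X *m _]ss; move: (sqrtmx tau) tt Ss => s tt Ss.
  transitivity ((ti *m t) *m (t *m t) *m (t *m ti)); first by rewrite -tt !mulmxA.
  by rewrite tit tti tt Ss -tt -mulmxA tS.
Qed.

(* If tau and omega have purifications with overlap c, then
   c^2 <= Tr (sqrt tau sqrt omega): write Y_i = tau^(1/4) Y'_i and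
   X_i = omega^(1/4) X'_i with sum_i Y'_i Y'_i^H = sqrt tau (similarly for X')
   and apply Cauchy-Schwarz. *)
Lemma affinity e m (I : finType) (X Y : I -> 'M[C]_(e, m))
    (tau omega : 'M[C]_e) :
  tau = \sum_i Y i *m (Y i)^H -> omega = \sum_i X i *m (X i)^H ->
  rtr tau <= 1 -> rtr omega <= 1 ->
  (\sum_i ip (X i) (Y i)) ^+ 2 <= rtr (sqrtmx tau *m sqrtmx omega).
Proof.
move=> deft defo tr_t tr_o.
have ht : psdmx tau by rewrite deft; apply: psdmx_sum => i; exact: psdmx_gramr.
have ho : psdmx omega.
  by rewrite defo; apply: psdmx_sum => i; exact: psdmx_gramr.
have [t [Y' [tH tt tY YY]]] := gram_quarter deft.
have [w [X' [wH ww wX XX]]] := gram_quarter defo.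
pose B := \sum_i Y' i *m (X' i)^H.
have -> : \sum_i ip (X i) (Y i) = ip (t *m w) B.
  rewrite ip_sumr; apply: eq_bigr => i _.
  by rewrite wX tY /ip !adjmxM wH tH !mulmxA [RHS]rtr_mulC !mulmxA.
have -> : rtr (sqrtmx tau *m sqrtmx omega) = sq (t *m w).
  by rewrite /ip adjmxM wH tH -tt -ww mulmxA rtr_mulC !mulmxA.
(* Expand [|B|^2] as the sum over pairs of [<Y'_j^H Y'_i, X'_j^H X'_i>] and use Cauchy-Schwarz. The
   sum of [|Y'_j^H Y'_i|^2] is the trace of [sqrt tau] squared, that is Tr [tau <= 1]; likewise for
   [X'] and [omega]. *)
have sqB1 : sq B <= 1.
  have fam (Z : I -> 'M[C]_(e, m)) (z : 'M[C]_e) : psdmx z ->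
      \sum_i Z i *m (Z i)^H = sqrtmx z ->
      \sum_(ij : I * I) sq ((Z ij.2)^H *m Z ij.1) = rtr z.
    move=> hz ZZ; rewrite -[in RHS](sqrtmxK hz) -ZZ mulmx_suml rtr_sum.
    rewrite -(pair_bigA _ (fun i j => sq ((Z j)^H *m Z i))) /=.
    apply: eq_bigr => i _; rewrite mulmx_sumr rtr_sum; apply: eq_bigr => j _.
    by rewrite -[in RHS]mulmxA [RHS]rtr_mulC /ip adjmxM adjmxK !mulmxA.
  have -> : sq B = \sum_(ij : I * I)
      ip ((Y' ij.2)^H *m Y' ij.1) ((X' ij.2)^H *m X' ij.1).
    rewrite -(pair_bigA _ (fun i j => ip ((Y' j)^H *m Y' i) ((X' j)^H *m X' i))) /=.
    rewrite [LHS]/ip adjmx_sum mulmx_suml rtr_sum; apply: eq_bigr => i _.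
    rewrite mulmx_sumr rtr_sum; apply: eq_bigr => j _.
    by rewrite adjmxM adjmxK -mulmxA [LHS]rtr_mulC /ip adjmxM adjmxK !mulmxA.
  apply: le_trans (ip_cauchy_sqrt _ _) _; rewrite (fam _ _ ht YY) (fam _ _ ho XX) -[leRHS]mulr1.
  by apply: ler_pM; rewrite ?sqrtr_ge0 // -[leRHS]sqrtr1 ler_wsqrtr.
have := @ip_cauchy R 'I_1 _ _ (fun _ => t *m w) (fun _ => B).
rewrite !big_ord1 => /le_trans; apply.
by rewrite -[leRHS]mulr1 ler_wpM2l ?sq_ge0.
Qed.

(* The operators L (inr j) send the kernel of Q to a fixed unit vector, which
   makes the polar part of Y trace preserving. *)
Lemma kraus_polar t d (I : finType) (Y : I -> 'M[C]_(t, d)) (Q : 'M[C]_d) :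
  (0 < t)%N -> Q = \sum_i (Y i)^H *m Y i ->
  exists L : I + 'I_d -> 'M[C]_(t, d),
    [/\ \sum_i (L i)^H *m L i = 1%:M,
        forall i, L (inl i) *m sqrtmx Q = Y i &
        forall j, L (inr j) *m sqrtmx Q = 0].
Proof.
move=> t_gt0 defQ.
have hQ : psdmx Q by rewrite defQ; apply: psdmx_sum => i; exact: psdmx_gram.
pose z : 'cV[C]_t := delta_mx (Ordinal t_gt0) 0.
have zz : z^H *m z = 1%:M.
  have -> : z^H = delta_mx 0 (Ordinal t_gt0).
    by apply/matrixP => a b; rewrite !mxE andbC; case: (_ && _);
      rewrite (rmorph0, rmorph1).
  by rewrite mul_delta_mx; apply/matrixP => i j; rewrite !ord1 !mxE !eqxx.
pose Z := 1%:M - suppmx Q.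
have ZH : Z^H = Z by rewrite adjmxB adjmx1 suppmx_herm.
have ZZ : Z *m Z = Z.
  by rewrite {1}/Z mulmxBl mul1mx /Z mulmxBr mulmx1 suppmx_idem subrr subr0.
exists (fun i => match i with inl i => Y i *m invsqrtmx Q
                 | inr j => z *m row j Z end); split=> [|i|j].
- rewrite big_sumType /=.
  transitivity (suppmx Q + Z); last by rewrite addrC subrK.
  congr (_ + _).
    rewrite -(invsqrtmxK hQ) [X in _ = _ *m X *m _]defQ mulmx_sumr mulmx_suml.
    apply: eq_bigr => i _.
    by move: (invsqrtmx Q) (invsqrtmx_herm hQ) => q qH; rewrite adjmxM qH !mulmxA.
  transitivity (Z^H *m Z); last by rewrite ZH ZZ.
  apply/matrixP => a b; rewrite summxE mxE.
  apply: eq_bigr => j _; rewrite adjmxM mulmxA -[_ *m z^H *m z]mulmxA zz mulmx1.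
  by rewrite mxE big_ord1 !mxE.
- by rewrite -mulmxA sqrtmxVr (gram_supp i defQ).
- rewrite -mulmxA -row_mul mulmxBl mul1mx suppmx_sqrt subrr.
  by apply/matrixP => a b; rewrite mxE big_ord1 !mxE mulr0.
Qed.

(** Gram-Schmidt on a row basis of [tau] gives orthonormal rows [W], and [V = W^H]. As [tau] is
    Hermitian, [tau = D W] turns into [tau = W^H D^H]. *)
Lemma support_isometry e (tau : 'M[C]_e) t : \rank tau = t -> tau^H = tau ->
  exists V : 'M[C]_(e, t), V^H *m V = 1%:M /\ V *m V^H *m tau = tau.
Proof.
move=> <- ht; pose W := schmidt (row_base tau).
have WW : W *m W^H = 1%:M by apply/unitarymxP/schmidt_unitarymx/rank_leq_col.
have /submxP[D tauE] : (tau <= W)%MS.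
  by apply: submx_trans (schmidt_sub _); rewrite eq_row_base.
have tauE' : tau = W^H *m D^H by rewrite -adjmxM -tauE ht.
exists W^H; rewrite adjmxK; split=> //.
by rewrite [X in _ *m X = _]tauE' -mulmxA (mulmxA W) WW mul1mx -tauE'.
Qed.

End Fidelity.

(** * Tensor products and Kraus representations of channels *)

Section Kraus.
Context {C : numClosedFieldType}.

Lemma sum_mxtens (V : nmodType) p q (F : 'I_(p * q) -> V) :
  \sum_m F m = \sum_(i < p) \sum_(k < q) F (mxtens_index (i, k)).
Proof.
rewrite pair_big /= (reindex (@mxtens_index p q)) /=.
  by apply: eq_bigr => -[i k].
exists (@mxtens_unindex p q) => m _; first exact: mxtens_indexK.
exact: mxtens_unindexK.
Qed.

Lemma eq_mxtens_index p q (i j : 'I_p) (k l : 'I_q) :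
  (mxtens_index (i, k) == mxtens_index (j, l)) = (i == j) && (k == l).
Proof. by rewrite (can_eq (@mxtens_indexK p q)) xpair_eqE. Qed.

Lemma tens_delta_mx p q r s (i : 'I_p) (j : 'I_q) (k : 'I_r) (l : 'I_s) :
  (delta_mx i j : 'M[C]_(p, q)) *t (delta_mx k l : 'M[C]_(r, s))
  = delta_mx (mxtens_index (i, k)) (mxtens_index (j, l)).
Proof.
apply/matrixP => m n; case: (mxtens_indexP m) => m1 m2.
case: (mxtens_indexP n) => n1 n2; rewrite tensmxE !mxE !eq_mxtens_index.
by rewrite -natrM mulnb andbACA.
Qed.

Lemma tens_suml p q r s (I : finType) (A : I -> 'M[C]_(p, q)) (B : 'M[C]_(r, s)) :
  (\sum_i A i) *t B = \sum_i A i *t B.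
Proof.
apply/matrixP => m n; rewrite summxE !mxE summxE mulr_suml.
by apply: eq_bigr => i _; rewrite !mxE.
Qed.

Lemma tens_sumr p q r s (I : finType) (A : 'M[C]_(p, q)) (B : I -> 'M[C]_(r, s)) :
  A *t (\sum_i B i) = \sum_i A *t B i.
Proof.
apply/matrixP => m n; rewrite summxE !mxE summxE mulr_sumr.
by apply: eq_bigr => i _; rewrite !mxE.
Qed.

Lemma tens_1mx p q : (1%:M : 'M[C]_p) *t (1%:M : 'M[C]_q) = 1%:M.
Proof.
apply/matrixP => m n; case: (mxtens_indexP m) => m1 m2.
case: (mxtens_indexP n) => n1 n2; rewrite tensmxE !mxE eq_mxtens_index.
by rewrite -natrM mulnb.
Qed.

Lemma mxtrace_tens p q (A : 'M[C]_p) (B : 'M[C]_q) :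
  \tr (A *t B) = \tr A * \tr B.
Proof.
rewrite /mxtrace sum_mxtens mulr_suml; apply: eq_bigr => i _.
by rewrite mulr_sumr; apply: eq_bigr => k _; rewrite tensmxE.
Qed.

Lemma matrix_sum_tens_delta p r (X : 'M[C]_(p * r)) :
  X = \sum_(i < p) \sum_(j < p) \sum_(k < r) \sum_(l < r)
    X (mxtens_index (i, k)) (mxtens_index (j, l))
      *: (delta_mx i j *t delta_mx k l).
Proof.
rewrite {1}(matrix_sum_delta X) sum_mxtens; apply: eq_bigr => i _.
rewrite [RHS]exchange_big /=; apply: eq_bigr => k _.
rewrite sum_mxtens; apply: eq_bigr => j _; apply: eq_bigr => l _.
by rewrite tens_delta_mx.
Qed.

Definition krausmap p q (I : finType) (K : I -> 'M[C]_(q, p)) (X : 'M[C]_p) :=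
  \sum_i K i *m X *m (K i)^H.

Lemma krausmap_is_linear p q (I : finType) (K : I -> 'M[C]_(q, p)) :
  linear (krausmap K).
Proof.
move=> a X Y; rewrite /krausmap scaler_sumr -big_split /=.
by apply: eq_bigr => i _; rewrite mulmxDr mulmxDl -scalemxAr -scalemxAl.
Qed.

HB.instance Definition _ p q (I : finType) (K : I -> 'M[C]_(q, p)) :=
  GRing.isLinear.Build C 'M[C]_p 'M[C]_q _ (krausmap K) (krausmap_is_linear K).

Lemma krausmap_delta p q (I : finType) (K : I -> 'M[C]_(q, p)) i j s t :
  krausmap K (delta_mx i j) s t = \sum_k K k s i * (K k t j)^*.
Proof.
rewrite summxE; apply: eq_bigr => k _.
rewrite -[delta_mx i j](mul_delta_mx (0 : 'I_1)) mulmxA -colE -mulmxA -rowE.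
by rewrite mxE big_ord1 !mxE.
Qed.

Lemma krausmap_id p : krausmap (fun _ : 'I_1 => 1%:M) =1 @id 'M[C]_p.
Proof. by move=> X; rewrite /krausmap big_ord1 adjmx1 mulmx1 mul1mx. Qed.

Lemma krausmap_pair p q (I J : finType) (F : I -> J -> 'M[C]_(q, p)) X :
  krausmap (fun ij : I * J => F ij.1 ij.2) X
  = \sum_i \sum_j F i j *m X *m (F i j)^H.
Proof. by rewrite pair_bigA. Qed.

Lemma tensmap_kraus p q r s (I J : finType) (K : I -> 'M[C]_(q, p))
    (L : J -> 'M[C]_(s, r)) (N : 'M[C]_p -> 'M[C]_q) (M : 'M[C]_r -> 'M[C]_s) :
  N =1 krausmap K -> M =1 krausmap L ->
  tensmap N M =1 krausmap (fun ij : I * J => K ij.1 *t L ij.2).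
Proof.
move=> hN hM X; rewrite [in RHS](matrix_sum_tens_delta X) /tensmap.
rewrite linear_sum; apply: eq_bigr => i _; rewrite linear_sum.
apply: eq_bigr => j _; rewrite linear_sum; apply: eq_bigr => k _.
rewrite linear_sum; apply: eq_bigr => l _; rewrite linearZ /=; congr (_ *: _).
rewrite hN hM tens_suml (krausmap_pair (fun i j => K i *t L j)).
apply: eq_bigr => a _; rewrite tens_sumr; apply: eq_bigr => b _.
by rewrite adjmx_tens !tensmx_mul.
Qed.

Lemma tensmap_idl_kraus p r s (J : finType) (L : J -> 'M[C]_(s, r))
    (M : 'M[C]_r -> 'M[C]_s) : M =1 krausmap L ->
  tensmap (@id 'M[C]_p) M =1 krausmap (fun j => 1%:M *t L j).
Proof.
move=> hM X; rewrite (tensmap_kraus (fsym (@krausmap_id p)) hM).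
by rewrite (krausmap_pair (fun _ j => 1%:M *t L j)) big_ord1.
Qed.

Lemma tensmap_idr_kraus p q r (I : finType) (K : I -> 'M[C]_(q, p))
    (N : 'M[C]_p -> 'M[C]_q) : N =1 krausmap K ->
  tensmap N (@id 'M[C]_r) =1 krausmap (fun i => K i *t 1%:M).
Proof.
move=> hN X; rewrite (tensmap_kraus hN (fsym (@krausmap_id r))).
rewrite (krausmap_pair (fun i _ => K i *t 1%:M)).
by apply: eq_bigr => i _; rewrite big_ord1.
Qed.

Lemma psdmx_krausmap p q (I : finType) (K : I -> 'M[C]_(q, p)) X :
  psdmx X -> psdmx (krausmap K X).
Proof. by move=> hX; apply: psdmx_sum => i; exact: psdmx_conj. Qed.

Lemma mxtrace_krausmap p q (I : finType) (K : I -> 'M[C]_(q, p)) X :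
  \tr (krausmap K X) = \tr ((\sum_i (K i)^H *m K i) *m X).
Proof.
rewrite mulmx_suml !raddf_sum; apply: eq_bigr => i _ /=.
by rewrite mxtrace_mulC mulmxA.
Qed.

Lemma cptp_krausmap p q (I : finType) (K : I -> 'M[C]_(q, p)) :
  \sum_i (K i)^H *m K i = 1%:M -> cptp (krausmap K).
Proof.
move=> hK; split=> [k X hX|X]; last by rewrite mxtrace_krausmap hK mul1mx.
by rewrite (@tensmap_idl_kraus _ _ _ _ K) //; exact: psdmx_krausmap.
Qed.

(** Any finite type may index the operators, so that tensor products and compositions are indexed by
    pairs. *)
Definition kraus_repr p q (N : 'M[C]_p -> 'M[C]_q) : Prop :=
  exists I : finType, exists K : I -> 'M[C]_(q, p),
    N =1 krausmap K /\ \sum_i (K i)^H *m K i = 1%:M.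

Lemma Gamma_mxE d (i j : 'I_d) k :
  Gamma C d (mxtens_index (i, j)) k = (i == j)%:R.
Proof.
rewrite summxE (bigD1 i) //= big1 ?addr0 => [|l li].
  by rewrite !mxE !mxtens_indexK !ord1 /= !eqxx mul1r andbT eq_sym.
by rewrite !mxE !mxtens_indexK /= eq_sym (negPf li) mul0r.
Qed.

Lemma sum_delta (I : finType) (a : I) (F : I -> C) :
  \sum_i (i == a)%:R * F i = F a.
Proof.
by rewrite (bigD1 a) //= eqxx mul1r big1 ?addr0 // => i /negPf->; rewrite mul0r.
Qed.

(* Choi: the columns of a square root of (id (x) N)(Gamma Gamma^H), reshaped
   into matrices, are Kraus operators. *)
Lemma cptp_kraus p q (N : {linear 'M[C]_p -> 'M[C]_q}) : cptp N -> kraus_repr N.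
Proof.
move=> [cpN tpN]; pose Ch := tensmap id N (Gamma C p *m (Gamma C p)^H).
have hCh : psdmx Ch by apply/cpN/psdmx_gramr.
have ChE i j s t :
    Ch (mxtens_index (i, s)) (mxtens_index (j, t)) = N (delta_mx i j) s t.
  transitivity (\sum_i' (i' == i)%:R * \sum_j' (j' == j)%:R *
    \sum_k (k == i')%:R * \sum_l (l == j')%:R * N (delta_mx k l) s t); last first.
    by rewrite !sum_delta.
  rewrite summxE; apply: eq_bigr => i' _.
  rewrite summxE mulr_sumr; apply: eq_bigr => j' _.
  rewrite summxE !mulr_sumr; apply: eq_bigr => k _.
  rewrite summxE !mulr_sumr; apply: eq_bigr => l _.
  rewrite mxE tensmxE mxE big_ord1 adjmxE !Gamma_mxE conjC_nat mxE.
  rewrite -mulnb natrM [i == _]eq_sym [j == _]eq_sym [k == _]eq_sym [l == _]eq_sym.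
  by move: (N _ _ _) => x; ring.
pose K (k : 'I_(p * q)) : 'M[C]_(q, p) :=
  \matrix_(s, i) sqrtmx Ch (mxtens_index (i, s)) k.
have NK : N =1 krausmap K.
  move=> X; rewrite [X]matrix_sum_delta !linear_sum; apply: eq_bigr => i _.
  rewrite !linear_sum; apply: eq_bigr => j _; rewrite !linearZ /=.
  congr (_ *: _); apply/matrixP => s t; rewrite -ChE krausmap_delta.
  rewrite -[in LHS](sqrtmxK hCh) mxE; apply: eq_bigr => k _.
  by rewrite -[in X in _ * X](sqrtmx_herm hCh) adjmxE !mxE.
exists 'I_(p * q), K; split=> //; apply/matrixP => a b.
(* Trace preservation on a matrix unit determines one entry of the sum of the [K_i^H K_i]. *)
have := tpN (delta_mx b a); rewrite NK mxtrace_krausmap.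
set S := \sum_i _.
have tr_delta (M : 'M[C]_p) : \tr (M *m delta_mx b a) = M a b.
  rewrite -(mul_delta_mx (0 : 'I_1)) mulmxA -colE mxtrace_mulC -rowE -mx11_tr.
  by rewrite !mxE.
by rewrite tr_delta -[delta_mx b a]mul1mx tr_delta.
Qed.

Lemma kraus_repr_tens p q r s (N : 'M[C]_p -> 'M[C]_q) (M : 'M[C]_r -> 'M[C]_s) :
  kraus_repr N -> kraus_repr M -> kraus_repr (tensmap N M).
Proof.
move=> [I [K [NK hK]]] [J [L [ML hL]]].
exists (I * J)%type, (fun ij => K ij.1 *t L ij.2); split.
  exact: tensmap_kraus.
rewrite -tens_1mx -hK -hL tens_suml.
rewrite -(pair_bigA _ (fun i j => (K i *t L j)^H *m (K i *t L j))) /=.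
apply: eq_bigr => i _; rewrite tens_sumr; apply: eq_bigr => j _.
by rewrite adjmx_tens tensmx_mul.
Qed.

Lemma kraus_repr_ntens p q (N : 'M[C]_p -> 'M[C]_q) n :
  kraus_repr N -> kraus_repr (ntensmap N n).
Proof.
move=> hN; case: n => [|n] /=.
  exists 'I_1, (fun=> 1%:M); split; first by move=> X; rewrite krausmap_id.
  by rewrite big_ord1 adjmx1 mulmx1.
by elim: n => [//|n IHn]; exact: kraus_repr_tens hN IHn.
Qed.

Lemma density_tens p q (A : 'M[C]_p) (B : 'M[C]_q) :
  density A -> density B -> density (A *t B).
Proof.
move=> [hA tA] [hB tB]; split; last by rewrite mxtrace_tens tA tB mulr1.
rewrite -(sqrtmxK hA) -(sqrtmxK hB) -tensmx_mul.
rewrite -{1}(sqrtmx_herm hA) -{1}(sqrtmx_herm hB) -adjmx_tens.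
exact: psdmx_gram.
Qed.

Lemma psdmx1 d : psdmx (1%:M : 'M[C]_d).
Proof. by have := psdmx_gram (1%:M : 'M[C]_d); rewrite adjmx1 mulmx1. Qed.

Lemma density_ntens p (A : 'M[C]_p) n : density A -> density (A ^t n).
Proof.
move=> hA; case: n => [|n].
  rewrite ntensmx0; split; last by rewrite mxtrace1.
  exact: (@psdmx1 1).
elim: n => [//|n IHn]; rewrite ntensmxSS; exact: density_tens.
Qed.

Lemma trmx_ntens p (A : 'M[C]_p) n : A^T ^t n = (A ^t n)^T.
Proof.
case: n => [|n]; first by rewrite !ntensmx0 trmx1.
by elim: n => [//|n IHn]; rewrite !ntensmxSS IHn trmx_tens.
Qed.

End Kraus.

(** * Bipartite vectors as operators, and canonical purifications *)

Section Vectorization.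
Context {C : numClosedFieldType}.

(* vec X = (1 (x) X)|Gamma>, the bipartite vector attached to the operator X. *)
Definition vec p q (X : 'M[C]_(q, p)) : 'cV[C]_(p * q) :=
  \col_m X (mxtens_unindex m).2 (mxtens_unindex m).1.

Lemma vecE p q (X : 'M[C]_(q, p)) i s k : vec X (mxtens_index (i, s)) k = X s i.
Proof. by rewrite mxE mxtens_indexK. Qed.

Lemma vecB p q (X Y : 'M[C]_(q, p)) : vec X - vec Y = vec (X - Y).
Proof. by apply/matrixP => m k; rewrite !mxE. Qed.

Lemma vec0 p q : vec (0 : 'M[C]_(q, p)) = 0.
Proof. by apply/matrixP => m k; rewrite !mxE. Qed.

Lemma tens_vec p q r s (A : 'M[C]_(r, p)) (B : 'M[C]_(s, q)) (X : 'M[C]_(q, p)) :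
  (A *t B) *m vec X = vec (B *m X *m A^T).
Proof.
apply/matrixP => m k; case: (mxtens_indexP m) => i u; rewrite vecE !mxE sum_mxtens.
apply: eq_bigr => j _; rewrite [(B *m X) _ _]mxE [A^T _ _]mxE mulr_suml.
by apply: eq_bigr => v _; rewrite tensmxE vecE; ring.
Qed.

Lemma mxtrace_vec p q (X Y : 'M[C]_(q, p)) :
  \tr ((vec X)^H *m vec Y) = \tr (X^H *m Y).
Proof.
rewrite -mx11_tr mxE sum_mxtens; apply: eq_bigr => i _; rewrite mxE.
by apply: eq_bigr => s _; rewrite adjmxE !vecE adjmxE.
Qed.

Lemma canon_vecE d (sigma : 'M[C]_d) : canon_vec sigma = vec (sqrtmx sigma).
Proof.
rewrite /canon_vec; have -> : Gamma C d = vec 1%:M.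
  apply/matrixP => m k; case: (mxtens_indexP m) => i j.
  by rewrite Gamma_mxE vecE mxE eq_sym.
by rewrite tens_vec trmx1 !mulmx1.
Qed.

Lemma ptrace1_vec p q (X : 'M[C]_(q, p)) :
  ptrace1 (vec X *m (vec X)^H) = X *m X^H.
Proof.
apply/matrixP => i j; rewrite !mxE; apply: eq_bigr => k _.
by rewrite mxE big_ord1 !adjmxE !vecE.
Qed.

Lemma ptrace1_sum p q (I : finType) (F : I -> 'M[C]_(p * q)) :
  ptrace1 (\sum_i F i) = \sum_i ptrace1 (F i).
Proof.
apply/matrixP => i j; rewrite summxE mxE.
under eq_bigr do rewrite summxE.
by rewrite exchange_big; apply: eq_bigr => l _; rewrite mxE.
Qed.

(** The operator [1 (x) <k|]; over all [k] these are Kraus operators of the trace over the second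
    factor. Writing this partial trace as a channel makes [trnorm_kraus] applicable to it. *)
Definition bra2 p q (k : 'I_q) : 'M[C]_(p, p * q) :=
  \matrix_(i, m) (m == mxtens_index (i, k))%:R.

Lemma bra2_complete p q : \sum_k (@bra2 p q k)^H *m bra2 p k = 1%:M.
Proof.
apply/matrixP => m n; case: (mxtens_indexP m) => a s.
case: (mxtens_indexP n) => b t; rewrite summxE mxE eq_mxtens_index.
transitivity (\sum_(k < q) (k == s)%:R * \sum_(i < p) (i == a)%:R *
    ((b == i) && (t == k))%:R : C); last first.
  by rewrite !sum_delta eq_sym [t == s]eq_sym.
apply: eq_bigr => k _; rewrite mxE mulr_sumr; apply: eq_bigr => i _.
rewrite adjmxE !mxE conjC_nat !eq_mxtens_index [a == i]eq_sym [s == k]eq_sym.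
by rewrite -mulnb natrM; ring.
Qed.

Lemma bra2_vec p q (X : 'M[C]_(q, p)) k : bra2 p k *m vec X = (row k X)^T.
Proof.
apply/matrixP => i j; rewrite !mxE; under eq_bigr do rewrite mxE.
by rewrite sum_delta vecE.
Qed.

(** The transpose relating a state to its reference marginal arises here. *)
Lemma bra2_gram_vec p q (X : 'M[C]_(q, p)) :
  krausmap (@bra2 p q) (vec X *m (vec X)^H) = (X^H *m X)^T.
Proof.
apply/matrixP => i j; rewrite summxE !mxE; apply: eq_bigr => k _.
rewrite mulmxA bra2_vec -mulmxA -adjmxM bra2_vec mxE big_ord1 !adjmxE !mxE.
by rewrite mulrC.
Qed.

Lemma tensmap_idl_pur p q (I : finType) (L : I -> 'M[C]_(q, p)) M (P : 'M[C]_p) :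
  M =1 krausmap L -> tensmap id M (canon_pur P)
  = \sum_i vec (L i *m sqrtmx P) *m (vec (L i *m sqrtmx P))^H.
Proof.
move=> ML; rewrite (tensmap_idl_kraus ML); apply: eq_bigr => i _.
rewrite /canon_pur canon_vecE; move: (sqrtmx _) => s.
rewrite !mulmxA -mulmxA -adjmxM.
by rewrite tens_vec trmx1 mulmx1.
Qed.

(** A channel on the system multiplies the operator of a vector from the left; a channel on the
    reference multiplies it from the right by transposed Kraus operators. *)
Lemma tensmap_idr_pur p q (I : finType) (K : I -> 'M[C]_(q, p)) N (tau : 'M[C]_p) :
  N =1 krausmap K -> tensmap N id (canon_pur tau)
  = \sum_i vec (sqrtmx tau *m (K i)^T) *m (vec (sqrtmx tau *m (K i)^T))^H.
Proof.
move=> NK; rewrite (tensmap_idr_kraus NK); apply: eq_bigr => i _.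
rewrite /canon_pur canon_vecE; move: (sqrtmx _) => s.
rewrite !mulmxA -mulmxA -adjmxM.
by rewrite tens_vec mul1mx.
Qed.

Lemma krausmapB p q (I : finType) (K : I -> 'M[C]_(q, p)) (X Y : 'M[C]_p) :
  krausmap K X - krausmap K Y = krausmap K (X - Y).
Proof. by rewrite linearB. Qed.

Lemma krausmap_trV p q (I : finType) (K : I -> 'M[C]_(q, p)) (X : 'M[C]_p) :
  (krausmap K X)^T = \sum_i ((K i)^T)^H *m X^T *m (K i)^T.
Proof.
rewrite raddf_sum; apply: eq_bigr => i _.
by rewrite /= !trmx_mul adjmx_tr mulmxA.
Qed.

End Vectorization.

(** * The two coding constructions and their error estimates *)

Section Coding.
Context {R : realType}.
Local Notation C := R[i].

Lemma kraus_ip p q m (I : finType) (K : I -> 'M[C]_(q, p)) (A B : 'M[C]_(p, m)) :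
  \sum_i (K i)^H *m K i = 1%:M -> \sum_i ip (K i *m A) (K i *m B) = ip A B.
Proof.
move=> hK; rewrite -[B in RHS]mul1mx -hK mulmx_suml ip_sumr.
by apply: eq_bigr => i _; rewrite ip_mull mulmxA.
Qed.

Lemma ip_vec p q (X Y : 'M[C]_(q, p)) : ip (vec X) (vec Y) = ip X Y.
Proof. by rewrite /ip /rtr mxtrace_vec. Qed.

Lemma sq_sqrtmx d (X : 'M[C]_d) : psdmx X -> sq (sqrtmx X) = rtr X.
Proof. by move=> hX; rewrite /ip sqrtmx_herm // sqrtmxK. Qed.

Lemma rtr_density d (X : 'M[C]_d) : density X -> rtr X = 1.
Proof. by case=> _ h; rewrite /rtr h. Qed.

Lemma ptrace1_output d e (M : 'M[C]_d -> 'M[C]_e) (P : 'M[C]_d) :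
  psdmx P -> kraus_repr M -> ptrace1 (tensmap id M (canon_pur P)) = M P.
Proof.
move=> hP [I [L [ML _]]]; rewrite (tensmap_idl_pur _ ML) ptrace1_sum ML.
apply: eq_bigr => i _; rewrite ptrace1_vec adjmxM (sqrtmx_herm hP) mulmxA.
by rewrite -(mulmxA (L i)) (sqrtmxK hP).
Qed.

(** Tracing out the second factor does not increase the trace norm. It leaves the reference marginal
    [P^T] of the first state, as [M] acts on the system only and preserves the trace, and
    [N (M P)^T] of the second. *)
Lemma trnorm_cover_le d e (M : 'M[C]_d -> 'M[C]_e) (N : 'M[C]_e -> 'M[C]_d)
    (P : 'M[C]_d) :
  psdmx P -> psdmx (M P) -> kraus_repr M -> kraus_repr N ->
  trnorm (P^T - N (M P)^T)
  <= trnorm (tensmap id M (canon_pur P) - tensmap N id (canon_pur (M P))).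
Proof.
move=> hP hMP [I [L [ML hL]]] [J [K [NK hK]]].
have e1 : krausmap (@bra2 _ d e) (tensmap id M (canon_pur P)) = P^T.
  rewrite (tensmap_idl_pur _ ML) linear_sum /=.
  under eq_bigr do rewrite bra2_gram_vec.
  rewrite -raddf_sum /=; congr (_^T).
  transitivity (sqrtmx P *m (\sum_i (L i)^H *m L i) *m sqrtmx P).
    rewrite mulmx_sumr mulmx_suml; apply: eq_bigr => i _.
    by rewrite adjmxM (sqrtmx_herm hP) !mulmxA.
  by rewrite hL mulmx1 (sqrtmxK hP).
have e2 : krausmap (@bra2 _ d e) (tensmap N id (canon_pur (M P))) = N (M P)^T.
  rewrite (tensmap_idr_pur _ NK) linear_sum NK; apply: eq_bigr => k _ /=.
  rewrite bra2_gram_vec.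
  transitivity (((K k)^T^H *m M P *m (K k)^T)^T).
    rewrite adjmxM (sqrtmx_herm hMP) -[in RHS](sqrtmxK hMP).
    by move: (sqrtmx _) => s; rewrite !mulmxA.
  by rewrite !trmx_mul adjmx_tr !trmxK mulmxA.
by rewrite -e1 -e2 krausmapB; exact: trnorm_kraus (bra2_complete d e).
Qed.

Lemma trnorm_tensmap_idr_le p q r (N : 'M[C]_p -> 'M[C]_q) (X Y : 'M[C]_(p * r)) :
  kraus_repr N -> trnorm (tensmap N id X - tensmap N id Y) <= trnorm (X - Y).
Proof.
move=> [I [K [NK hK]]].
rewrite (tensmap_idr_kraus NK X) (tensmap_idr_kraus NK Y) krausmapB.
apply: trnorm_kraus; rewrite -tens_1mx -hK tens_suml.
by apply: eq_bigr => i _; rewrite adjmx_tens tensmx_mul adjmx1 mulmx1.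
Qed.

Lemma trnorm_gram1 d m (x y : 'M[C]_(d, m)) : sq x <= 1 -> sq y <= 1 ->
  trnorm (x *m x^H - y *m y^H) <= 2 * Num.sqrt (sq (x - y)).
Proof.
move=> hx hy; have := @trnorm_gram R _ 'I_1 _ (fun=> x) (fun=> y).
by rewrite !big_ord1; apply.
Qed.

Lemma trnorm_canon_pur d (X Y : 'M[C]_d) :
  psdmx X -> psdmx Y -> rtr X = 1 -> rtr Y = 1 ->
  trnorm (canon_pur X - canon_pur Y)
  <= 2 * Num.sqrt (sq (sqrtmx X - sqrtmx Y)).
Proof.
move=> hX hY tX tY; rewrite /canon_pur (canon_vecE X) (canon_vecE Y).
rewrite -(sq_sqrtmx hX) in tX; rewrite -(sq_sqrtmx hY) in tY.
move: (sqrtmx X) (sqrtmx Y) tX tY => S T sS sT.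
rewrite -(ip_vec (S - T)) -vecB; apply: trnorm_gram1.
  by rewrite ip_vec sS.
by rewrite ip_vec sT.
Qed.

(** Because [c^2 >= 2 c - 1], the defect [1 - c <= eps] at most doubles on passing to [a]. The bound
    stays linear in [eps], which avoids a fourth root in the final error. *)
Lemma affinity_arith (c a eps : R) :
  1 + 1 - 2 * c <= 2 * eps -> c ^+ 2 <= a -> 1 + 1 - 2 * a <= 4 * eps.
Proof. by have := sqr_ge0 (1 - c); lra. Qed.

(** Both roots are bounded by [2 sqrt eps], so the constant is [2 * 2 + 2 * 2 = 8]; the factor 1/2
    in the trace distance later turns it into 4. *)
Lemma sqrt_arith (eps u v w : R) : 0 <= 2 * eps -> w <= u + v ->
  u <= 2 * Num.sqrt (2 * eps) -> v <= 2 * Num.sqrt (4 * eps) ->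
  w <= 8 * Num.sqrt eps.
Proof.
move=> eps2 wuv hu hv; have eps_ge0 : 0 <= eps by lra.
have s4 : Num.sqrt (4 * eps) = 2 * Num.sqrt eps.
  have -> : 4 * eps = 2 ^+ 2 * eps by ring.
  by rewrite sqrtrM ?exprn_ge0 // sqrtr_sqr ger0_norm.
have s2 : Num.sqrt (2 * eps) <= 2 * Num.sqrt eps.
  by rewrite -s4 ler_wsqrtr //; lra.
by lra.
Qed.

Lemma cover_protocol d e t (P : 'M[C]_d) (sigma : 'M[C]_e)
    (N : 'M[C]_e -> 'M[C]_d) (eps : R) :
  density P -> density sigma -> \rank sigma = t -> kraus_repr N ->
  trnorm (P^T - N sigma) <= 2 * eps ->
  exists (I : finType) (L : I -> 'M[C]_(t, d)) (V : 'M[C]_(e, t)),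
    [/\ \sum_i (L i)^H *m L i = 1%:M, V^H *m V = 1%:M &
    let omega := tensmap id (krausmap (fun i => V *m L i)) (canon_pur P) in
    trnorm (omega - tensmap N id (canon_pur (ptrace1 omega)))
      <= 8 * Num.sqrt eps].
Proof.
move=> dP ds rk_s [J [K [NK hK]]] dist.
have [hP _] := dP; have [hs tr_s] := ds.
pose tau := sigma^T; have ht : psdmx tau by exact: psdmx_tr.
(* A state has trace 1, hence nonzero rank; the polar construction needs a unit vector in the code
   space. *)
have t_gt0 : (0 < t)%N.
  rewrite -rk_s lt0n mxrank_eq0; apply/eqP => s0; move: tr_s.
  by rewrite s0 mxtrace0 => /esym/eqP; rewrite oner_eq0.
have [V [VV Vtau]] : exists V : 'M[C]_(e, t), V^H *m V = 1%:M /\ V *m V^H *m tau = tau.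
  by apply: support_isometry; [rewrite mxrank_tr | exact: psdmx_herm].
have [st [stE stH stK Vst]] : exists st : 'M[C]_e,
    [/\ st = sqrtmx tau, st^H = st, st *m st = tau & V *m V^H *m st = st].
  exists (sqrtmx tau); split=> //; [exact: sqrtmx_herm | exact: sqrtmxK |].
  (* The projection [V V^H] fixes [tau], and this factorization shows that it fixes [sqrt tau]
     too. *)
  have -> : sqrtmx tau = tau *m invsqrtmx tau.
    by rewrite -{2}(sqrtmxK ht) -mulmxA sqrtmxVl sqrtmx_supp.
  by rewrite mulmxA Vtau.
have tau1 : rtr tau = 1 by rewrite rtr_tr; exact: rtr_density.
pose Y k : 'M[C]_(t, d) := V^H *m st *m (K k)^T.
pose Q := \sum_k (Y k)^H *m Y k.
have VY k : V *m Y k = st *m (K k)^T by rewrite /Y !mulmxA Vst.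
have QE : Q = (N sigma)^T.
  rewrite NK krausmap_trV; apply: eq_bigr => k _.
  transitivity (((K k)^T)^H *m (st *m (V *m V^H *m st)) *m (K k)^T).
    by rewrite /Y !adjmxM adjmxK stH !mulmxA.
  by rewrite Vst stK.
have hQ : psdmx Q by apply: psdmx_sum => k; exact: psdmx_gram.
clearbody tau.
have rtrQ : rtr Q = 1.
  by rewrite QE rtr_tr /rtr NK mxtrace_krausmap hK mul1mx tr_s.
have [L [hL LY L0]] := kraus_polar t_gt0 (erefl Q).
exists (J + 'I_d)%type, L, V; split=> //.
move=> omega.
have [S SE] : exists S : 'M[C]_d, S = sqrtmx P by exists (sqrtmx P).
have [T TE] : exists T : 'M[C]_d, T = sqrtmx Q by exists (sqrtmx Q).
rewrite -TE in LY L0.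
(* The same isometric family is applied to [sqrt P] and to [sqrt Q]. The vectors of [x] give
   [omega]; those of [y] give [(N (x) id)(Psi_tau)], padded with zeros for the indices [inr j]. *)
pose x l := V *m L l *m S; pose y l := V *m L l *m T.
have hVL : \sum_l (V *m L l)^H *m (V *m L l) = 1%:M.
  by rewrite -hL; apply: eq_bigr => l _; rewrite adjmxM mulmxA -(mulmxA _ V^H) VV mulmx1.
have sqST : sq (S - T) <= 2 * eps.
  have := powers_stormer (psdmx_sqrt hP) (psdmx_sqrt hQ).
  rewrite (sqrtmxK hP) (sqrtmxK hQ) -SE -TE -trnorm_tr => /le_trans; apply.
  apply: le_trans dist.
  by rewrite raddfB /= QE trmxK.
have sqS : sq S = 1 by rewrite SE (sq_sqrtmx hP) rtr_density.
have sqT : sq T = 1 by rewrite TE (sq_sqrtmx hQ).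
have omegaE : omega = \sum_l vec (x l) *m (vec (x l))^H.
  by rewrite /omega /x SE; exact: tensmap_idl_pur.
have oAE : ptrace1 omega = \sum_l x l *m (x l)^H.
  by rewrite omegaE ptrace1_sum; apply: eq_bigr => l _; rewrite ptrace1_vec.
set oA := ptrace1 omega in oAE *.
clearbody oA omega.
have hoA : psdmx oA by rewrite oAE; apply: psdmx_sum => l; exact: psdmx_gramr.
have y_inl k : y (inl k) = st *m (K k)^T by rewrite /y -mulmxA LY VY.
have y_inr j : y (inr j) = 0 by rewrite /y -mulmxA L0 mulmx0.
have xiE : tensmap N id (canon_pur tau) = \sum_l vec (y l) *m (vec (y l))^H.
  rewrite (tensmap_idr_pur _ NK) -stE big_sumType /= [X in _ + X]big1 ?addr0.
    by apply: eq_bigr => k _; rewrite y_inl.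
  by move=> j _; rewrite y_inr vec0 mul0mx.
(* This is the marginal of [(N (x) id)(Psi_tau)] on the second factor, unchanged because [N]
   preserves the trace. *)
have tauE : tau = \sum_l y l *m (y l)^H.
  rewrite big_sumType /= [X in _ + X]big1 ?addr0; last first.
    by move=> j _; rewrite y_inr mul0mx.
  transitivity (st *m (\sum_k (K k)^H *m K k)^T *m st).
    by rewrite hK trmx1 mulmx1 stK.
  rewrite raddf_sum mulmx_sumr mulmx_suml; apply: eq_bigr => k _ /=.
  by rewrite y_inl adjmxM stH trmx_mul adjmx_tr !mulmxA.
have oA1 : rtr oA = 1.
  rewrite oAE rtr_sum -sqS -(kraus_ip S S hVL); apply: eq_bigr => l _.
  by rewrite rtr_mulC.
have d1 : trnorm (omega - tensmap N id (canon_pur tau)) <= 2 * Num.sqrt (2 * eps).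
  rewrite omegaE xiE.
  apply: le_trans (trnorm_gram (x := fun l => vec (x l)) (y := fun l => vec (y l)) _ _) _.
  - by under eq_bigr do rewrite ip_vec; rewrite (kraus_ip _ _ hVL) sqS.
  - by under eq_bigr do rewrite ip_vec; rewrite (kraus_ip _ _ hVL) sqT.
  under eq_bigr do rewrite vecB ip_vec -mulmxBr.
  by rewrite (kraus_ip _ _ hVL) ler_wpM2l // ler_wsqrtr.
(* The operators [V L_l] preserve inner products, so the families [x] and [y], which decompose [oA]
   and [tau], have total overlap [<S, T>]. *)
have aff : ip S T ^+ 2 <= rtr (st *m sqrtmx oA).
  rewrite -(kraus_ip S T hVL) stE; apply: affinity tauE oAE _ _.
    by rewrite tau1.
  by rewrite oA1.
have sqst : sq (st - sqrtmx oA) <= 4 * eps.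
  have eST := sqB S T; rewrite sqS sqT in eST.
  have eso : sq (st - sqrtmx oA) = 1 + 1 - 2 * rtr (st *m sqrtmx oA).
    by rewrite sqB (sq_sqrtmx hoA) oA1 [in X in X + _]stE (sq_sqrtmx ht) tau1 /ip stH.
  move: sqST aff; rewrite eST eso => h1 h2.
  exact: affinity_arith h1 h2.
(* Contractivity of [N] on the reference reduces this to the distance of the two canonical
   purifications, hence to that of their roots. *)
have d2 : trnorm (tensmap N id (canon_pur tau) - tensmap N id (canon_pur oA))
    <= 2 * Num.sqrt (4 * eps).
  apply: le_trans (trnorm_tensmap_idr_le _ _ _) _; first by exists J, K.
  apply: le_trans (trnorm_canon_pur ht hoA tau1 oA1) _.
  by rewrite -stE ler_wpM2l // ler_wsqrtr.
have := trnormD (omega - tensmap N id (canon_pur tau))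
  (tensmap N id (canon_pur tau) - tensmap N id (canon_pur oA)).
rewrite addrA subrK => d12.
have eps2 := le_trans (sq_ge0 (S - T)) sqST.
exact (sqrt_arith eps2 d12 d1 d2).
Qed.

End Coding.

(** * Composition of channels, ranks under isometries, and the equivalence of the two kinds of
    code *)

Lemma kraus_repr_comp (C : numClosedFieldType) p q r
    (N : 'M[C]_p -> 'M[C]_q) (M : 'M[C]_q -> 'M[C]_r) :
  kraus_repr N -> kraus_repr M -> kraus_repr (M \o N).
Proof.
move=> [I [K [NK hK]]] [J [L [ML hL]]].
exists (J * I)%type, (fun ji => L ji.1 *m K ji.2); split=> [X|].
  rewrite /= NK ML (krausmap_pair (fun j i => L j *m K i)).
  apply: eq_bigr => j _; rewrite mulmx_sumr mulmx_suml; apply: eq_bigr => i _.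
  by rewrite adjmxM !mulmxA.
rewrite -(pair_bigA _ (fun j i => (L j *m K i)^H *m (L j *m K i))) /= exchange_big.
rewrite -hK; apply: eq_bigr => i _.
transitivity ((K i)^H *m (\sum_j (L j)^H *m L j) *m K i); last by rewrite hL mulmx1.
rewrite mulmx_sumr mulmx_suml; apply: eq_bigr => j _.
by rewrite adjmxM !mulmxA.
Qed.

Lemma kraus_repr_density (C : numClosedFieldType) p q (N : 'M[C]_p -> 'M[C]_q) X :
  kraus_repr N -> density X -> density (N X).
Proof.
move=> [I [K [NK hK]]] [hX tX]; rewrite NK; split; first exact: psdmx_krausmap.
by rewrite mxtrace_krausmap hK mul1mx.
Qed.

Lemma mxrank_isometry (C : numClosedFieldType) p q (V : 'M[C]_(q, p)) X :
  V^H *m V = 1%:M -> \rank (V *m X *m V^H) = \rank X.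
Proof.
move=> VV; apply/eqP; rewrite eqn_leq; apply/andP; split.
  exact: leq_trans (mxrankM_maxl _ _) (mxrankM_maxr _ _).
have {1}-> : X = V^H *m (V *m X *m V^H) *m V.
  by rewrite !mulmxA VV mul1mx -mulmxA VV mulmx1.
exact: leq_trans (mxrankM_maxl _ _) (mxrankM_maxr _ _).
Qed.

Lemma eq_tensmap_idl (C : numClosedFieldType) p r s (M M' : 'M[C]_r -> 'M[C]_s) X :
  M =1 M' -> tensmap (@id 'M[C]_p) M X = tensmap id M' X.
Proof. by move=> e; do 4!apply: eq_bigr => ? _; rewrite e. Qed.

(** In (1) the covering state has the rank of the encoded source, which may be below [Theta]; rank
    exactly [Theta] is concluded when the encoded source has full rank. For [n = 1],
    [a = b = Theta = 2], [eps = 0], [N = id] and pure [rho], identity maps form a protocol, while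
    the only covering state is [rho^T], of rank 1. *)
Theorem lemma24 (R : realType) (a b : nat) (rho : 'M[R[i]]_b)
    (N : {linear 'M[R[i]]_a -> 'M[R[i]]_b}) (n Theta : nat) (eps : R)
    (rho_density : density rho) (N_cptp : cptp N) :
  (forall (E : {linear 'M[R[i]]_(b ^ n) -> 'M[R[i]]_Theta})
          (D : {linear 'M[R[i]]_Theta -> 'M[R[i]]_(a ^ n)}),
     lossy_protocol rho N n Theta eps E D -> isometric_channel D ->
     (exists2 Theta' : nat, (Theta' <= Theta)%N &
        exists sigma : 'M[R[i]]_(a ^ n),
          covering_code rho^T N n Theta' eps sigma) /\
     (\rank (E (rho ^t n)) = Theta ->
        exists sigma : 'M[R[i]]_(a ^ n),
          covering_code rho^T N n Theta eps sigma)) /\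
  ((exists sigma : 'M[R[i]]_(a ^ n), covering_code rho^T N n Theta eps sigma) ->
     exists (E : {linear 'M[R[i]]_(b ^ n) -> 'M[R[i]]_Theta})
            (D : {linear 'M[R[i]]_Theta -> 'M[R[i]]_(a ^ n)}),
       lossy_protocol rho N n Theta (4 * Num.sqrt eps) E D).
Proof.
have dP := density_ntens n rho_density.
have kN := kraus_repr_ntens n (cptp_kraus N_cptp).
split=> [E D [cE cD dist] [V [VV DV]]|[sigma [ds rk_s dist]]].
  have kM := kraus_repr_comp (cptp_kraus cE) (cptp_kraus cD).
  have [hM tM] := kraus_repr_density kM dP.
  move: dist; rewrite /protocol_output (ptrace1_output dP.1 kM) => dist.
  (* The marginal of [omega] on the second factor is [D (E (rho ^t n))]. Transposition and
     conjugation by the decoding isometry both keep the rank of [E (rho ^t n)]. *)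
  have cover : covering_code rho^T N n (\rank (E (rho ^t n))) eps
      (D (E (rho ^t n)))^T.
    split.
    - by split; [exact: psdmx_tr | rewrite mxtrace_tr].
    - by rewrite mxrank_tr DV mxrank_isometry.
    apply: le_trans dist; rewrite /trdist trmx_ntens ler_wpM2l ?invr_ge0 //.
    exact: trnorm_cover_le dP.1 hM kM kN.
  split=> [|rkE]; last by exists (D (E (rho ^t n)))^T; rewrite -{1}rkE.
  exists (\rank (E (rho ^t n))); first exact: rank_leq_row.
  by exists (D (E (rho ^t n)))^T.
have dist2 : trnorm ((rho ^t n)^T - ntensmap N n sigma) <= 2 * eps.
  by move: dist; rewrite /trdist trmx_ntens mulrC ler_pdivrMr // mulrC.
have [I [L [V [hL VV res]]]] := cover_protocol dP ds rk_s kN dist2.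
exists (krausmap L : {linear 'M[R[i]]_(b ^ n) -> 'M[R[i]]_Theta}).
(* A single Kraus operator: the decoder is conjugation by the isometry [V]. *)
exists (krausmap (fun _ : 'I_1 => V) : {linear 'M[R[i]]_Theta -> 'M[R[i]]_(a ^ n)}).
split; [exact: cptp_krausmap | by apply: cptp_krausmap; rewrite big_ord1 |].
rewrite /protocol_output (eq_tensmap_idl (M' := krausmap (fun i => V *m L i))).
  rewrite /trdist mulrC ler_pdivrMr //; apply: le_trans res _.
  by rewrite mulrAC -natrM.
move=> X; rewrite /= {1}/krausmap big_ord1 mulmx_sumr mulmx_suml.
by apply: eq_bigr => i _; rewrite adjmxM !mulmxA.
Qed.
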